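(* Let $\Bbbk$ be a field. There exist an integer $d>2$ and a 2-$d$-determined graded $\Bbbk$-algebra $C$ of infinite global dimension such that the Yoneda algebra $E(C)$ is finitely generated as a $\Bbbk$-algebra but $C$ is not $\mathcal{K}_2$.
   Context: All graded algebras considered are of the form $R=\mathbb{T}(V)/I$, where $V$ is a finite dimensional $\Bbbk$-vector space in degree $1$, $\mathbb{T}(V)$ is the free (tensor) algebra on $V$, and $I$ is a homogeneous ideal that can be generated by elements of $\mathbb{T}(V)_2$ and $\mathbb{T}(V)_d$ for an integer $d>2$. Yoneda algebra: $E(R):=\bigoplus_{i,j}\operatorname{Ext}_R^{i,j}(\Bbbk,\Bbbk)$, a bigraded algebra under the Yoneda product, where $i$ is the cohomological degree and $j$ is the internal degree inherited from the grading on $R$. Write $E^{i,j}(R)=\operatorname{Ext}_R^{i,j}(\Bbbk,\Bbbk)$ and $E^i(R)=\bigoplus_j E^{i,j}(R)$. $R$ is $\mathcal{K}_2$ if $E(R)$ is generated as a $\Bbbk$-algebra by $E^1(R)$ and $E^2(R)$. 2-$d$-determined: define $\delta(2m)=dm$, $\delta(2m+1)=dm+1$ for $m\ge 0$. The algebra $R=\mathbb{T}(V)/I$, with $I$ generated by elements of degrees $2$ and $d$, is called 2-$d$-determined if $E^{i,j}(R)=0$ unless $j\le\delta(i)$. *)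

(* Defs.v *)
From HB Require Import structures.
From mathcomp Require Import all_boot all_order all_algebra.
From mathcomp Require Import finmap monalg.

Set Implicit Arguments.
Unset Strict Implicit.
Unset Printing Implicit Defensive.

Import GRing.Theory.
Local Open Scope ring_scope.

(** ** Graded algebras T(V)/I, with I generated in degrees 2 and d *)

(* T(V) for V = k^n in degree 1: the k-algebra of the free monoid on 'I_n. *)
Notation tensor_alg k n := {malg k[{fmonom 'I_n}]}.

Definition homog (k : fieldType) (n j : nat) (t : tensor_alg k n) : Prop :=
  forall w : {fmonom 'I_n}, w \in msupp t -> fdeg w = j.

Definition two_sided_ideal (T : nzRingType) (G : T -> Prop) (t : T) : Prop :=
  exists s : seq (T * T * T),
    (forall u, u \in s -> G u.1.2) /\ t = \sum_(u <- s) u.1.1 * u.1.2 * u.2.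

(* A k-algebra with a chosen identification with T(V)/I: [ga_pi] is the
   projection T(V) -> T(V)/I, [ga_rel] a set of generators of I. *)
Record graded_alg (k : fieldType) (d : nat) := GradedAlg {
  ga_alg :> algType k;
  ga_dim : nat;
  ga_pi : {lrmorphism tensor_alg k ga_dim -> ga_alg};
  ga_rel : tensor_alg k ga_dim -> Prop;
  ga_pi_surj : forall a : ga_alg, exists t, ga_pi t = a;
  ga_ker : forall t, ga_pi t = 0 <-> two_sided_ideal ga_rel t;
  ga_rel_deg : forall t, ga_rel t -> homog 2 t \/ homog d t;
  (* the augmentation, i.e. the quotient of the algebra by its part of
     positive degree; it is determined by [ga_augE] *)
  ga_aug : {rmorphism ga_alg -> k};
  ga_augE : forall t : tensor_alg k ga_dim, ga_aug (ga_pi t) = mcoeff mone t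
}.

Definition ga_piece (k : fieldType) (d : nat) (C : graded_alg k d) (j : nat)
    (a : C) : Prop :=
  exists2 t, homog j t & ga_pi C t = a.

(* The trivial left module: k, on which C acts through the augmentation. *)
Definition trivmod (k : fieldType) (d : nat) (C : graded_alg k d) : Type := k.

Section TrivialModule.
Variables (k : fieldType) (d : nat) (C : graded_alg k d).

HB.instance Definition _ := GRing.Zmodule.copy (trivmod C) k.

Definition triv_scale (a : C) (x : trivmod C) : trivmod C :=
  ga_aug C a * (x : k).

Fact triv_scaleA a b x : triv_scale a (triv_scale b x) = triv_scale (a * b) x.
Proof. by rewrite /triv_scale rmorphM mulrA. Qed.
Fact triv_scale1 : left_id 1 triv_scale.
Proof. by move=> x; rewrite /triv_scale rmorph1 mul1r. Qed.
Fact triv_scaleDr : right_distributive triv_scale +%R.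
Proof. by move=> a x y; rewrite /triv_scale mulrDr. Qed.
Fact triv_scaleDl x : {morph triv_scale^~ x : a b / a + b}.
Proof. by move=> a b; rewrite /triv_scale rmorphD mulrDl. Qed.

HB.instance Definition _ :=
  GRing.Zmodule_isLmodule.Build C (trivmod C)
    triv_scaleA triv_scale1 triv_scaleDr triv_scaleDl.
End TrivialModule.

(** ** Projective resolutions and global dimension *)

Definition projective (A : nzRingType) (P : lmodType A) : Prop :=
  forall (M N : lmodType A) (g : {linear M -> N}) (f : {linear P -> N}),
    (forall y, exists x, g x = y) ->
    exists h : {linear P -> M}, forall x, g (h x) = f x.

Record resolution (A : nzRingType) (M : lmodType A) := Resolution {
  res_mod :> nat -> lmodType A;
  res_d : forall i, {linear res_mod i.+1 -> res_mod i};
  res_aug : {linear res_mod 0%N -> M};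
  res_proj : forall i, projective (res_mod i);
  res_aug_surj : forall m, exists x, res_aug x = m;
  res_exact0 : forall x, res_aug x = 0 <-> exists y, res_d 0 y = x;
  res_exact : forall i (x : res_mod i.+1),
    res_d i x = 0 <-> exists y, res_d i.+1 y = x
}.

Definition pd_le (A : nzRingType) (M : lmodType A) (n : nat) : Prop :=
  exists P : resolution M, forall i, (n < i)%N -> forall x : P i, x = 0.

Definition infinite_gldim (A : nzRingType) : Prop :=
  forall n, ~ (forall M : lmodType A, pd_le M n).

(** ** Graded projective resolutions of the trivial module *)

(* M is the internal direct sum of the subgroups [gr j], j in Z, and C_i maps
   M_j into M_(i+j). *)
Record is_grading (k : fieldType) (d : nat) (C : graded_alg k d)
    (M : lmodType C) (gr : int -> M -> Prop) : Prop := IsGrading {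
  gr_zero : forall j, gr j 0;
  gr_add : forall j x y, gr j x -> gr j y -> gr j (x + y);
  gr_scale : forall (i : nat) j (a : C) x,
    ga_piece i a -> gr j x -> gr (i%:Z + j) (a *: x);
  gr_span : forall x, exists (s : seq int) (y : int -> M),
    (forall j, gr j (y j)) /\ x = \sum_(j <- s) y j;
  gr_indep : forall (s : seq int) (y : int -> M),
    uniq s -> (forall j, gr j (y j)) -> \sum_(j <- s) y j = 0 ->
    forall j, j \in s -> y j = 0
}.

Record graded_resolution (k : fieldType) (d : nat) (C : graded_alg k d) :=
  GradedResolution {
  gres :> resolution (trivmod C : lmodType C);
  gres_gr : forall i, int -> gres i -> Prop;
  gres_grP : forall i, is_grading (@gres_gr i);
  gres_d_deg : forall i j x,
    gres_gr (i := i.+1) j x -> gres_gr (i := i) j (res_d gres i x);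
  gres_aug_deg : forall j x,
    gres_gr (i := 0%N) j x -> j != 0 -> res_aug gres x = 0
}.

(** ** The Yoneda algebra *)

(* E(C) is the cohomology of Hom_C(P, k).  An element of the total space, the
   sum over all (i, j), is represented by the family of its components
   f i : P_i -> k, subject to [cocycle] and up to [cohomologous].
   By the comparison theorem, none of the properties below depends on P. *)
Section Yoneda.
Variables (k : fieldType) (d : nat) (C : graded_alg k d).
Variable P : graded_resolution C.

Definition hom_family := forall i, {linear P i -> (trivmod C : lmodType C)}.

(* Finitely many nonzero bihomogeneous components. *)
Definition finite_support (f : hom_family) : Prop :=
  exists B : nat, forall i j x, gres_gr j x -> f i x != 0 ->
    (i <= B)%N /\ (`|j|%N <= B)%N.

Definition cocycle (f : hom_family) : Prop :=
  finite_support f /\ forall i x, f i (res_d P i x) = 0.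

Definition cohomologous (f g : hom_family) : Prop :=
  exists2 u : hom_family, finite_support u &
    (forall x, f 0%N x = g 0%N x) /\
    (forall i x, f i.+1 x = g i.+1 x + u i (res_d P i x)).

Definition null_class (f : hom_family) : Prop :=
  exists2 u : hom_family, finite_support u &
    (forall x, f 0%N x = 0) /\ (forall i x, f i.+1 x = u i (res_d P i x)).

(* f lies in E^i(C), the sum of the E^(i,j)(C) over j. *)
Definition in_E (i : nat) (f : hom_family) : Prop :=
  cocycle f /\ forall i' x, i' <> i -> f i' x = 0.

(* f lies in E^(i,j)(C). *)
Definition in_Ebi (i : nat) (j : int) (f : hom_family) : Prop :=
  in_E i f /\ forall j' x, gres_gr (i := i) j' x -> j' <> j -> f i x = 0.

Definition yoneda_one (f : hom_family) : Prop :=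
  (forall x, f 0%N x = res_aug P x) /\ (forall i x, f i.+1 x = 0).

(* [phi n i], for i <= n, is the component P_n -> P_i of a lift to P of the
   component g (n - i) of g; no sign is put on the lift. *)
Definition lifts (g : hom_family) (phi : forall n i, {linear P n -> P i}) : Prop :=
  (forall n x, res_aug P (phi n 0%N x) = g n x) /\
  (forall n i x, res_d P i (phi n.+1 i.+1 x) = phi n i (res_d P n x)).

Definition yoneda_mul (f g h : hom_family) : Prop :=
  exists2 phi : forall n i, {linear P n -> P i}, lifts g phi &
    forall n x, h n x = \sum_(i < n.+1) f i (phi n i x).

(* The cocycles whose class is in the k-subalgebra of E(C) generated by the
   classes of the elements of S. *)
Inductive generated (S : hom_family -> Prop) : hom_family -> Prop :=
| Gen_in f : S f -> cocycle f -> generated S f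
| Gen_one f : yoneda_one f -> cocycle f -> generated S f
| Gen_lin (c : k) (f g h : hom_family) :
    generated S f -> generated S g ->
    (forall i x, (h i x : k) = c * (f i x : k) + (g i x : k)) ->
    cocycle h -> generated S h
| Gen_mul f g h :
    generated S f -> generated S g -> yoneda_mul f g h ->
    cocycle h -> generated S h
| Gen_eq f h :
    generated S f -> cohomologous f h -> cocycle h -> generated S h.

Definition yoneda_fin_gen : Prop :=
  exists (r : nat) (s : 'I_r -> hom_family), (forall l, cocycle (s l)) /\
    forall f, cocycle f -> generated (fun g => exists l, g = s l) f.

Definition is_K2 : Prop :=
  forall f, cocycle f -> generated (fun g => in_E 1 g \/ in_E 2 g) f.

Definition delta (i : nat) : nat := (d * i./2 + odd i)%N.

Definition two_d_determined : Prop :=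
  forall (i : nat) (j : int), ~~ (j <= (delta i)%:Z) ->
    forall f, in_Ebi i j f -> null_class f.
End Yoneda.

(* Main.v *)
Require Import Defs.
From HB Require Import structures.
From mathcomp Require Import all_boot all_order all_algebra.
From mathcomp Require Import finmap monalg ring zify.

(** Let C = k<x, y>/(xy, x^2 - yx); a basis is 1, x, x^2, y, y^2, ....  As left
    modules C_+ = Cx (+) Cy, while the left annihilators of y, x, x - y and x^2 are
    Cx, C(x - y), Cx^2 and C_+ respectively, and Cx^2 is a copy of k.  The syzygies
    of the trivial module k thus run through the four modules k, Cx, Cy, C(x - y)
    along the graph k -> Cx, k -> Cy, Cy -> Cx, Cx -> C(x - y), C(x - y) -> k, and
    the paths of length n starting at k index a basis of the n-th term of a minimal
    free resolution of k.  All the arrows raise the internal degree by 1, except for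
    the last one, which raises it by 2 and occurs at most once in three steps.
    Cutting paths at their returns to k, the Yoneda algebra is generated by the two
    loops, of lengths 3 and 4, and by the five nontrivial paths that do not return
    to k.  The loop of length 3 is a class in E^(3,4), which E^(1,1) and E^(2,2)
    cannot generate. *)

Set Implicit Arguments.
Unset Strict Implicit.
Unset Printing Implicit Defensive.

Import GRing.Theory.
Local Open Scope ring_scope.

(* [Mixed p a b] stands for [p(y) + a x + b x^2]. *)
Record mixed (k : fieldType) := Mixed { cy : {poly k}; cx : k; cxx : k }.

(** * The algebra [C] in coordinates *)

Section MixedRing.
Variable k : fieldType.
Implicit Types u v w : mixed k.

Lemma mixedP u v : cy u = cy v -> cx u = cx v -> cxx u = cxx v -> u = v.
Proof. by case: u v => [? ? ?] [? ? ?] /= -> -> ->. Qed.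

Fact mixed_tripleK :
  cancel (fun u => (cy u, cx u, cxx u)) (fun t => Mixed t.1.1 t.1.2 t.2).
Proof. by case. Qed.
HB.instance Definition _ := Choice.copy (mixed k) (can_type mixed_tripleK).

Definition mixed_add u v := Mixed (cy u + cy v) (cx u + cx v) (cxx u + cxx v).
Definition mixed_opp u := Mixed (- cy u) (- cx u) (- cxx u).

Fact mixed_addA : associative mixed_add.
Proof. by move=> u v w; apply: mixedP; rewrite /= addrA. Qed.
Fact mixed_addC : commutative mixed_add.
Proof. by move=> u v; apply: mixedP; rewrite /= addrC. Qed.
Fact mixed_add0 : left_id (Mixed 0 0 0) mixed_add.
Proof. by move=> u; apply: mixedP; rewrite /= add0r. Qed.
Fact mixed_addN : left_inverse (Mixed 0 0 0) mixed_opp mixed_add.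
Proof. by move=> u; apply: mixedP; rewrite /= addNr. Qed.
HB.instance Definition _ := GRing.isZmodule.Build (mixed k)
  mixed_addA mixed_addC mixed_add0 mixed_addN.

(** The relations [xy = 0] and [yx = x^2] give [x^3 = x(yx) = (xy)x = 0] and then
    [y^2 x = y x^2 = x^3 = 0]. Hence [p(y)] acts on [x] from the left through its coefficients of
    degree 0 and 1, and on [x^2], or from the right, through its constant term. *)
Definition mixed_mul u v := Mixed (cy u * cy v)
  ((cy u)`_0 * cx v + cx u * (cy v)`_0)
  ((cy u)`_0 * cxx v + (cy u)`_1 * cx v + cx u * cx v + cxx u * (cy v)`_0).

Lemma coef1M (p q : {poly k}) : (p * q)`_1 = p`_0 * q`_1 + p`_1 * q`_0.
Proof. by rewrite coefM !big_ord_recl big_ord0 addr0. Qed.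

Fact mixed_mulA : associative mixed_mul.
Proof.
by move=> u v w; apply: mixedP; rewrite /= ?mulrA // ?coef0M ?coef1M; ring.
Qed.
Fact mixed_mul1 : left_id (Mixed 1 0 0) mixed_mul.
Proof. by move=> u; apply: mixedP; rewrite /= ?mul1r // !coef1 /=; ring. Qed.
Fact mixed_mulr1 : right_id (Mixed 1 0 0) mixed_mul.
Proof. by move=> u; apply: mixedP; rewrite /= ?mulr1 // !coef1 /=; ring. Qed.
Fact mixed_mulDl : left_distributive mixed_mul +%R.
Proof.
by move=> u v w; apply: mixedP; rewrite /= ?mulrDl // ?coefD; ring.
Qed.
Fact mixed_mulDr : right_distributive mixed_mul +%R.
Proof.
by move=> u v w; apply: mixedP; rewrite /= ?mulrDr // ?coefD; ring.
Qed.
Fact mixed_one_neq0 : Mixed 1 0 0 != 0 :> mixed k.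
Proof. by apply/eqP => /(congr1 (@cy k))/eqP; rewrite oner_eq0. Qed.
HB.instance Definition _ := GRing.Zmodule_isNzRing.Build (mixed k)
  mixed_mulA mixed_mul1 mixed_mulr1 mixed_mulDl mixed_mulDr mixed_one_neq0.

Definition mixed_scale (c : k) u := Mixed (c *: cy u) (c * cx u) (c * cxx u).

Fact mixed_scaleA (a b : k) u : mixed_scale a (mixed_scale b u) = mixed_scale (a * b) u.
Proof. by apply: mixedP; rewrite /= ?scalerA ?mulrA. Qed.
Fact mixed_scale1 : left_id 1 mixed_scale.
Proof. by move=> u; apply: mixedP; rewrite /= ?scale1r ?mul1r. Qed.
Fact mixed_scaleDr : right_distributive mixed_scale +%R.
Proof. by move=> c u v; apply: mixedP; rewrite /= ?scalerDr ?mulrDr. Qed.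
Fact mixed_scaleDl u : {morph mixed_scale^~ u : a b / a + b}.
Proof. by move=> a b; apply: mixedP; rewrite /= ?scalerDl ?mulrDl. Qed.
HB.instance Definition _ := GRing.Zmodule_isLmodule.Build k (mixed k)
  mixed_scaleA mixed_scale1 mixed_scaleDr mixed_scaleDl.

Lemma coordD u v :
  (cy (u + v) = cy u + cy v) * (cx (u + v) = cx u + cx v)
  * (cxx (u + v) = cxx u + cxx v).
Proof. by []. Qed.
Lemma coordN u : (cy (- u) = - cy u) * (cx (- u) = - cx u) * (cxx (- u) = - cxx u).
Proof. by []. Qed.
Lemma coord0 : (cy 0 = 0 :> {poly k}) * (cx 0 = 0 :> k) * (cxx 0 = 0 :> k).
Proof. by []. Qed.
Lemma coord1 : (cy 1 = 1 :> {poly k}) * (cx 1 = 0 :> k) * (cxx 1 = 0 :> k).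
Proof. by []. Qed.
Lemma coordZ (c : k) u :
  (cy (c *: u) = c *: cy u) * (cx (c *: u) = c * cx u) * (cxx (c *: u) = c * cxx u).
Proof. by []. Qed.
Lemma coordM u v :
  (cy (u * v) = cy u * cy v) *
  (cx (u * v) = (cy u)`_0 * cx v + cx u * (cy v)`_0) *
  (cxx (u * v) = (cy u)`_0 * cxx v + (cy u)`_1 * cx v
     + cx u * cx v + cxx u * (cy v)`_0).
Proof. by []. Qed.
Definition coordE := (coordD, coordN, coord0, coord1, coordZ, coordM).

Fact mixed_scaleAl (c : k) u v : c *: (u * v) = c *: u * v.
Proof. by apply: mixedP; rewrite !coordE ?scalerAl // ?coefZ; ring. Qed.
HB.instance Definition _ := GRing.Lmodule_isLalgebra.Build k (mixed k) mixed_scaleAl.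

Fact mixed_scaleAr (c : k) u v : c *: (u * v) = u * (c *: v).
Proof. by apply: mixedP; rewrite !coordE ?scalerAr // ?coefZ; ring. Qed.
HB.instance Definition _ := GRing.Lalgebra_isAlgebra.Build k (mixed k) mixed_scaleAr.

Definition mixed_x : mixed k := Mixed 0 1 0.
Definition mixed_y : mixed k := Mixed 'X 0 0.

Definition letter (i : 'I_2) : mixed k := if val i == 0 then mixed_x else mixed_y.

Definition word_val (w : {fmonom 'I_2}) : mixed k := \prod_(i <- w) letter i.

Fact word_val_mmorphism : mmorphism word_val.
Proof.
split; first by move=> w1 w2; rewrite /word_val fmM big_cat.
by rewrite /word_val fm1 big_nil.
Qed.

HB.instance Definition _ :=
  isMultiplicative.Build _ _ word_val word_val_mmorphism.

Definition mixed_eval (t : tensor_alg k 2) : mixed k :=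
  mmap (in_alg (mixed k)) word_val t.

Fact mixed_eval_additive : additive mixed_eval.
Proof. exact: mmap_is_additive. Qed.
HB.instance Definition _ :=
  GRing.isAdditive.Build _ _ mixed_eval mixed_eval_additive.

Fact mixed_eval_multiplicative : multiplicative mixed_eval.
Proof.
apply: commr_mmap_is_multiplicative => g m m'; rewrite /GRing.comm /=.
by rewrite -scalerAl -scalerAr mul1r mulr1.
Qed.

HB.instance Definition _ :=
  GRing.isMultiplicative.Build _ _ mixed_eval mixed_eval_multiplicative.

Fact mixed_eval_scalable : scalable mixed_eval.
Proof. by move=> c t; rewrite /mixed_eval mmapZ /= -scalerAl mul1r. Qed.

HB.instance Definition _ :=
  GRing.isScalable.Build k _ _ *:%R mixed_eval mixed_eval_scalable.


Definition mixed_aug (u : mixed k) : k := (cy u)`_0.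

Fact mixed_aug_additive : additive mixed_aug.
Proof. by move=> u v; rewrite /mixed_aug !coordE coefD coefN. Qed.
Fact mixed_aug_multiplicative : multiplicative mixed_aug.
Proof. by split=> [u v|]; rewrite /mixed_aug ?coordE ?coef0M ?coef1. Qed.
HB.instance Definition _ := GRing.isAdditive.Build _ _ mixed_aug mixed_aug_additive.
HB.instance Definition _ :=
  GRing.isMultiplicative.Build _ _ mixed_aug mixed_aug_multiplicative.

End MixedRing.

(** * Closure properties of two-sided ideals *)

Section Ideals.
Variables (T : nzRingType) (G : T -> Prop).
Implicit Types t u : T.
Local Notation I := (two_sided_ideal G).

Lemma ideal0 : I 0.
Proof. by exists [::]; split=> //; rewrite big_nil. Qed.

Lemma idealD t u : I t -> I u -> I (t + u).
Proof.
move=> [s [sP ->]] [s' [s'P ->]]; exists (s ++ s'); split; last by rewrite big_cat.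
by move=> w; rewrite mem_cat => /orP [/sP|/s'P].
Qed.

Lemma idealMl t u : I u -> I (t * u).
Proof.
move=> [s [sP ->]]; exists [seq (t * w.1.1, w.1.2, w.2) | w <- s]; split.
  by move=> w /mapP [w' /sP w'P ->].
by rewrite big_map mulr_sumr; apply: eq_bigr => w _; rewrite /= !mulrA.
Qed.

Lemma idealMr t u : I u -> I (u * t).
Proof.
move=> [s [sP ->]]; exists [seq (w.1.1, w.1.2, w.2 * t) | w <- s]; split.
  by move=> w /mapP [w' /sP w'P ->].
by rewrite big_map mulr_suml; apply: eq_bigr => w _; rewrite /= !mulrA.
Qed.

Lemma ideal_gen t : G t -> I t.
Proof.
move=> tG; exists [:: (1, t, 1)]; split; first by move=> u /[!inE] /eqP ->.
by rewrite big_seq1 mul1r mulr1.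
Qed.

Lemma ideal_trans t u : I (t - u) -> I u -> I t.
Proof. by move=> /idealD h /h; rewrite subrK. Qed.
End Ideals.

(** * Normal forms modulo [XY] and [YX - X^2], and the kernel of the evaluation *)

Section NormalForm.
Variables (k : fieldType) (T : lalgType k) (X Y : T).
Implicit Types (t : T) (u : mixed k) (p : {poly k}).

Definition rels t : Prop := t = X * Y \/ t = Y * X - X * X.
Local Notation I := (two_sided_ideal rels).

Lemma idealZ (c : k) t : I t -> I (c *: t).
Proof. by move=> tI; rewrite -[t]mul1r scalerAl; apply: idealMl. Qed.

(** The normal form as an element of [T]: a linear section of the evaluation, by [mixed_liftK]. *)
Definition mixed_lift u : T :=
  (map_poly (in_alg T) (cy u)).[Y] + cx u *: X + cxx u *: (X * X).

Lemma mixed_lift_linear : linear mixed_lift.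
Proof.
move=> c u v; rewrite /mixed_lift !coordE rmorphD /= map_polyZ hornerD hornerZ /=.
rewrite -scalerAl mul1r !scalerDl !scalerDr !scalerA [RHS]addrACA; congr (_ + _).
by rewrite [RHS]addrACA.
Qed.

HB.instance Definition _ :=
  GRing.isLinear.Build k (mixed k) T _ mixed_lift mixed_lift_linear.

Section Evaluation.
Variable f : {lrmorphism T -> mixed k}.
Hypotheses (fX : f X = mixed_x k) (fY : f Y = mixed_y k).

Lemma eval_polyY p : f (map_poly (in_alg T) p).[Y] = Mixed p 0 0.
Proof.
elim/poly_ind: p => [|p c IHp]; first by rewrite rmorph0 horner0 raddf0.
rewrite rmorphD rmorphM /= map_polyX map_polyC hornerD hornerMX hornerC /=.
rewrite rmorphD rmorphM /= IHp fY linearZ rmorph1 /=.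
by apply: mixedP; rewrite !coordE /= ?alg_polyC ?coefX //=; ring.
Qed.

Lemma mixed_liftK : cancel mixed_lift f.
Proof.
move=> u; rewrite /mixed_lift !linearD !linearZ /= rmorphM /= fX eval_polyY.
by apply: mixedP; rewrite !coordE /= ?coef0 ?scaler0 ?mulr0 ?addr0 //; ring.
Qed.

Lemma eval_rel t : rels t -> f t = 0.
Proof.
case=> ->; rewrite ?rmorphB !rmorphM /= !(fX, fY);
 by apply: mixedP; rewrite !coordE /= ?coefX ?coef0 ?mulr0 ?mul0r ?subr0 //=; ring.
Qed.

(** Modulo the relations, [X^3 = X(YX) = (XY)X]. *)
Lemma ideal_XXX : I (X * X * X).
Proof.
apply: (@ideal_trans _ _ _ (X * (Y * X))).
  rewrite -mulrA -mulrBr -opprB mulrN -mulNr.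
  by apply/idealMl/ideal_gen; right.
by rewrite mulrA; apply/idealMr/ideal_gen; left.
Qed.

(** Modulo the ideal, [Y(YX) = YX^2 = X^3 = 0], so the powers [Y^j] with [j >= 2] kill [X]. *)
Lemma ideal_polyX p :
  I ((map_poly (in_alg T) p).[Y] * X - (p`_0 *: X + p`_1 *: (X * X))).
Proof.
have YX : I (Y * X - X * X) by apply: ideal_gen; right.
(* Here and below [poly_ind] merely splits off the lowest coefficient. After two rounds there remain
   a left multiple of [YYX] and a scalar multiple of [YX - X^2]. *)
elim/poly_ind: p => [|p c _].
  by rewrite rmorph0 horner0 !coef0 !scale0r mul0r addr0 subrr; apply: ideal0.
rewrite rmorphD rmorphM /= map_polyX map_polyC hornerD hornerMX hornerC /=.
rewrite !coefD !coefMX !coefC /= add0r addr0 mulrDl -scalerAl mul1r.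
rewrite opprD addrA addrK.
elim/poly_ind: p => [|p e _].
  by rewrite rmorph0 horner0 !coef0 !scale0r !mul0r subrr; apply: ideal0.
rewrite rmorphD rmorphM /= map_polyX map_polyC hornerD hornerMX hornerC /=.
rewrite !coefD !coefMX !coefC /= add0r !mulrDl -!scalerAl mul1r -addrA.
rewrite -scalerBr; apply: idealD; last exact: idealZ.
rewrite -!mulrA; apply: idealMl; apply: (@ideal_trans _ _ _ (Y * (X * X))).
  by rewrite -mulrBr; apply: idealMl.
rewrite mulrA; apply: (@ideal_trans _ _ _ (X * X * X)); last exact: ideal_XXX.
by rewrite -mulrBl; apply: idealMr.
Qed.

Lemma ideal_liftX u : I (mixed_lift u * X - mixed_lift (u * mixed_x k)).
Proof.
have -> : u * mixed_x k = Mixed 0 (cy u)`_0 ((cy u)`_1 + cx u).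
  by apply: mixedP; rewrite !coordE /= ?coef0 ?mulr0 //; ring.
case: u => p a b; rewrite /mixed_lift /= rmorph0 horner0 add0r.
rewrite !mulrDl -!scalerAl scalerDl.
rewrite [X in _ - X]addrA opprD [X in X + _]addrAC addrACA subrr addr0 addrAC.
by apply: idealD; [apply: ideal_polyX | apply/idealZ/ideal_XXX].
Qed.

Lemma ideal_liftY u : I (mixed_lift u * Y - mixed_lift (u * mixed_y k)).
Proof.
have XY : I (X * Y) by apply: ideal_gen; left.
have -> : u * mixed_y k = Mixed (cy u * 'X) 0 0.
  by apply: mixedP; rewrite !coordE /= ?coefX //=; ring.
case: u => p a b; rewrite /mixed_lift /= !scale0r !addr0.
rewrite rmorphM /= map_polyX hornerMX !mulrDl -!scalerAl addrC !addrA addNr add0r.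
by apply: idealD; apply: idealZ => //; rewrite -mulrA; apply: idealMl.
Qed.

Hypothesis T_ind : forall P : T -> Prop,
  P 0 -> (forall (c : k) t t', P t -> P t' -> P (c *: t + t')) ->
  P 1 -> (forall t, P t -> P (t * X)) -> (forall t, P t -> P (t * Y)) ->
  forall t, P t.

(** Words grow by letters on the right ([T_ind]), and modulo the ideal the normal forms are stable
    under right multiplication by [X] and [Y]. *)
Lemma ideal_lift_eval t : I (t - mixed_lift (f t)).
Proof.
elim/T_ind: t => [|c t t' It It'||t It|t It].
- by rewrite !raddf0 addr0; apply: ideal0.
- rewrite [f _]linearP mixed_lift_linear opprD addrACA -scalerBr.
  by apply: idealD => //; apply: idealZ.
- rewrite rmorph1 /mixed_lift !coord1 rmorph1 hornerC !scale0r !addr0 subrr.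
  exact: ideal0.
- apply: (@ideal_trans _ _ _ (mixed_lift (f t) * X - mixed_lift (f (t * X)))).
    by rewrite opprB addrA subrK -mulrBl; apply: idealMr.
  by rewrite rmorphM /= fX; apply: ideal_liftX.
- apply: (@ideal_trans _ _ _ (mixed_lift (f t) * Y - mixed_lift (f (t * Y)))).
    by rewrite opprB addrA subrK -mulrBl; apply: idealMr.
  by rewrite rmorphM /= fY; apply: ideal_liftY.
Qed.

Lemma eval_kernel t : f t = 0 <-> I t.
Proof.
split=> [ft0|[s [sG ->]]].
  by have := ideal_lift_eval t; rewrite ft0 raddf0 subr0.
rewrite raddf_sum big_seq big1 // => u /sG uG.
by rewrite /= !rmorphM /= (eval_rel uG) mulr0 mul0r.
Qed.
End Evaluation.
End NormalForm.

(** * Annihilators and homogeneous components in [C] *)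

Section Coordinates.
Variable k : fieldType.
Implicit Types a b : mixed k.
Local Notation x := (mixed_x k).
Local Notation y := (mixed_y k).

Definition mixed_xx : mixed k := Mixed 0 0 1.

Lemma mixed_mulx a : a * x = Mixed 0 (cy a)`_0 ((cy a)`_1 + cx a).
Proof. by apply: mixedP; rewrite !coordE /= ?coef0 ?mulr0 //; ring. Qed.

Lemma mixed_muly a : a * y = Mixed (cy a * 'X) 0 0.
Proof. by apply: mixedP; rewrite !coordE /= ?coefX //=; ring. Qed.

Lemma mixed_mulxx a : a * mixed_xx = Mixed 0 0 (cy a)`_0.
Proof. by apply: mixedP; rewrite !coordE /= ?coef0 ?mulr0 //; ring. Qed.

Lemma mixed_mulxy a : a * (x - y) = Mixed (- (cy a * 'X)) (cy a)`_0 ((cy a)`_1 + cx a).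
Proof.
by rewrite mulrBr mixed_mulx mixed_muly; apply: mixedP; rewrite !coordE /= ?sub0r ?subr0.
Qed.

Lemma polyX_div (p : {poly k}) : p`_0 = 0 -> exists q, p = q * 'X.
Proof.
elim/poly_ind: p => [|p c _]; first by exists 0; rewrite mul0r.
by rewrite coefD coefMX coefC add0r => -> ; exists p; rewrite addr0.
Qed.

Lemma ann_x a : a * x = 0 <-> exists b, b * (x - y) = a.
Proof.
split=> [|[b <-]]; last first.
  rewrite mixed_mulxy mixed_mulx; apply: mixedP => //=.
    by rewrite coefN coefMX oppr0.
  by rewrite !coefN !coefMX addNr.
rewrite mixed_mulx => /[dup] /(congr1 (@cx k)) /= a0 /(congr1 (@cxx k)) /= a1.
(* Comparing coordinates in [b * (x - y) = a] forces first the polynomial part [- q] of [b], then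
   its [x]-coordinate. The [x]-coordinates of both sides agree because [a * x = 0]. *)
have [q yq] := polyX_div a0; exists (Mixed (- q) (cxx a + q`_1) 0).
rewrite mixed_mulxy; apply: mixedP; rewrite /= ?mulNr ?opprK ?yq // !coefN.
  by apply/eqP; rewrite eq_sym -addr_eq0 addrC -[X in _ == X]a1 yq coefMX.
by rewrite addrC addrK.
Qed.

Lemma ann_y a : a * y = 0 <-> exists b, b * x = a.
Proof.
split=> [|[b <-]]; last by rewrite mixed_mulx mixed_muly /= mul0r.
rewrite mixed_muly => /(congr1 (@cy k)) /= /eqP; rewrite mulf_eq0 polyX_eq0 orbF => /eqP a0.
exists (Mixed (cx a)%:P (cxx a) 0); rewrite mixed_mulx.
by apply: mixedP; rewrite /= ?a0 ?coefC //= add0r.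
Qed.

Lemma ann_xy a : a * (x - y) = 0 <-> exists b, b * mixed_xx = a.
Proof.
split=> [|[b <-]]; last first.
  by rewrite mixed_mulxx mixed_mulxy; apply: mixedP; rewrite !coordE /= ?mul0r ?oppr0 ?coef0 ?addr0.
rewrite mixed_mulxy => /[dup] /(congr1 (@cxx k)) /= a1 /(congr1 (@cy k)) /= /eqP.
rewrite oppr_eq0 mulf_eq0 polyX_eq0 orbF => /eqP a0.
exists (Mixed (cxx a)%:P 0 0); rewrite mixed_mulxx.
by apply: mixedP; rewrite /= ?a0 ?coefC //= -a1 a0 coef0 add0r.
Qed.

Lemma ann_xx a : a * mixed_xx = 0 <-> mixed_aug a = 0.
Proof.
rewrite mixed_mulxx /mixed_aug; split=> [/(congr1 (@cxx k)) //|/= ->].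
by apply: mixedP.
Qed.

Lemma aug_ideal a : mixed_aug a = 0 <-> exists b c, b * x + c * y = a.
Proof.
split=> [/polyX_div [q yq]|[b [c <-]]]; last first.
  by rewrite mixed_mulx mixed_muly /mixed_aug !coordE /= add0r coefMX.
exists (Mixed (cx a)%:P (cxx a) 0), (Mixed q 0 0); rewrite mixed_mulx mixed_muly.
by apply: mixedP; rewrite !coordE /= ?coefC /= ?add0r ?addr0.
Qed.

(** [Cx] is spanned by [x] and [x^2], while [Cy] consists of polynomials in [y]. *)
Lemma xy_direct a b : a * x + b * y = 0 -> a * x = 0 /\ b * y = 0.
Proof.
rewrite mixed_mulx mixed_muly => e; split; apply: mixedP => //=.
- by have := congr1 (@cx k) e; rewrite /= addr0.
- by have := congr1 (@cxx k) e; rewrite /= addr0.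
- by have := congr1 (@cy k) e; rewrite /= add0r.
Qed.

(** The projection onto degree [i]. It turns the existential [ga_piece] into a fixed-point
    condition, see [piece_hcomp]. *)
Definition hcomp (i : nat) a : mixed k :=
  Mixed ((cy a)`_i *: 'X^i) (cx a *+ (i == 1)) (cxx a *+ (i == 2)).

Lemma hcomp_linear i : linear (hcomp i).
Proof.
move=> c a b; apply: mixedP; rewrite !coordE /=.
- by rewrite coefD coefZ scalerDl scalerA.
- by rewrite mulrnDl mulrnAr.
- by rewrite mulrnDl mulrnAr.
Qed.
HB.instance Definition _ i :=
  GRing.isLinear.Build k (mixed k) (mixed k) _ (hcomp i) (hcomp_linear i).

Lemma hcompK i j a : hcomp i (hcomp j a) = if i == j then hcomp j a else 0.
Proof.
case: eqP => [->|/eqP ij]; apply: mixedP; rewrite /= ?coefZ ?coefXn.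
- by rewrite eqxx mulr1.
- by rewrite -mulrnA mulnb andbb.
- by rewrite -mulrnA mulnb andbb.
- by rewrite (negPf ij) mulr0 scale0r.
- by rewrite -mulrnA mulnb; case: (j =P 1) ij => [->|] // /negPf ->.
- by rewrite -mulrnA mulnb; case: (j =P 2) ij => [->|] // /negPf ->.
Qed.

(** The bound 3 makes room for [x^2], of degree 2 whatever the size of the polynomial part. *)
Lemma hcomp_sum a N : (3 <= N)%N -> (size (cy a) <= N)%N -> \sum_(i < N) hcomp i a = a.
Proof.
move=> N3 aN.
have S (g : nat -> mixed k) n :
  \sum_(i < n) g i = Mixed (\sum_(i < n) cy (g i)) (\sum_(i < n) cx (g i)) (\sum_(i < n) cxx (g i)).
  by elim: n => [|n IHn]; rewrite ?big_ord0 // !big_ord_recr /= IHn.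
rewrite (S (hcomp^~ a)); apply: mixedP; rewrite /=.
- rewrite -{2}[cy a]coefK poly_def (big_ord_widen _ (fun i => (cy a)`_i *: 'X^i) aN).
  rewrite [RHS]big_mkcond; apply: eq_bigr => i _; case: ltnP => // /leq_sizeP -> //.
  by rewrite scale0r.
- rewrite (bigD1 (Ordinal (ltnW N3))) //= mulr1n big1 ?addr0 // => i.
  by rewrite -val_eqE /= => /negPf ->.
- rewrite (bigD1 (Ordinal N3)) //= mulr1n big1 ?addr0 // => i.
  by rewrite -val_eqE /= => /negPf ->.
Qed.

Lemma hcomp_letterM i (l : 'I_2) a :
  hcomp i (letter k l * a) = if i is j.+1 then letter k l * hcomp j a else 0.
Proof.
rewrite /letter; case: ifP => _; case: i => [|i]; apply: mixedP; rewrite !coordE /= ?coefX /=;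
  rewrite ?coef0 ?mul0r ?mul1r ?coef0 ?scale0r ?mul0rn ?add0r ?addr0 ?coefXM
    ?scale0r //=.
- by rewrite coefZ coefXn; case: i => [|i]; rewrite ?mulr1 ?mulr0.
- by rewrite exprS scalerAr.
- by rewrite mul0rn.
Qed.

Lemma hcomp_word i (s : seq 'I_2) :
  hcomp i (\prod_(l <- s) letter k l) = if i == size s then \prod_(l <- s) letter k l else 0.
Proof.
elim: s i => [|l s IHs] [|i]; rewrite ?big_nil ?big_cons ?hcomp_letterM ?IHs //.
- by apply: mixedP; rewrite /= ?coef1 ?scale1r ?mul0rn.
- by apply: mixedP; rewrite /= ?coef1 ?scale0r ?mul0rn.
- by rewrite eqSS; case: eqP => // _; rewrite mulr0.
Qed.
End Coordinates.

(** * Homogeneous tensors *)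

Section Homogeneous.
Variables (k : fieldType) (n : nat).
Local Notation T := (tensor_alg k n).
Implicit Types t u : T.

Lemma homogD j t u : homog j t -> homog j u -> homog j (t + u).
Proof.
move=> tj uj w /(fsubsetP (msuppD_le _ _)); rewrite in_fsetU.
by case/orP => [/tj|/uj].
Qed.

Lemma homogZ j (c : k) t : homog j t -> homog j (c *: t).
Proof. by move=> tj w /(fsubsetP (msuppZ_le _ _))/tj. Qed.

Lemma homogN j t : homog j t -> homog j (- t).
Proof. by move=> tj w; rewrite msuppN => /tj. Qed.

Lemma homogM i j t u : homog i t -> homog j u -> homog (i + j) (t * u).
Proof. by move=> ti uj w /msuppM_le [w1 [w2 [/ti <- /uj <- ->]]]; rewrite fdegM. Qed.

Lemma homog1 : homog 0 (1 : T).
Proof. by move=> w; rewrite msuppU oner_eq0 in_fset1 => /eqP ->; rewrite fdeg1. Qed.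

Lemma homog_letter (i : 'I_n) : homog 1 (<< fmu i >> : T).
Proof. by move=> w; rewrite msuppU oner_eq0 in_fset1 => /eqP ->; rewrite fdegU. Qed.

Lemma homogX i t : homog 1 t -> homog i (t ^+ i).
Proof.
move=> t1; elim: i => [|i IHi]; first exact: homog1.
by rewrite exprS -add1n; apply: homogM.
Qed.

Lemma homog0 j : homog j (0 : T).
Proof. by move=> w; rewrite msupp0 in_fset0. Qed.
End Homogeneous.

(** * The presentation of [C] as a quotient of the tensor algebra *)

Section Presentation.
Variable k : fieldType.
Local Notation T := (tensor_alg k 2).

Definition tX : T := << fmu (ord0 : 'I_2) >>.
Definition tY : T := << fmu (ord_max : 'I_2) >>.

Lemma tensor_ind (P : T -> Prop) :
  P 0 -> (forall (c : k) t t', P t -> P t' -> P (c *: t + t')) ->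
  P 1 -> (forall t, P t -> P (t * tX)) -> (forall t, P t -> P (t * tY)) ->
  forall t, P t.
Proof.
move=> P0 PD P1 PX PY t; rewrite (monalgE t).
apply: big_rec => // w u _ Pu.
have -> : << t@_w *g w >> = t@_w *: << w >> :> T.
  by apply/malgP => w'; rewrite mcoeffZ !mcoeffU mulr_natr.
apply: PD Pu; case: w => s {u t}; elim/last_ind: s => [|s i IHs].
  by rewrite -[FMonom _]fmoneE.
have -> : << FMonom (rcons s i) >> = << FMonom s >> * << fmu i >> :> T.
  rewrite malgM_def fgmulUU mulr1; congr (<< _ >>); apply/eqP.
  by rewrite fmP fmM fmU cats1.
case: (unliftP ord0 i) => [j ->|->]; last exact: PX.
by rewrite (_ : lift _ _ = ord_max) ?ord1 //; [exact: PY | exact: val_inj].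
Qed.

Lemma mixed_evalX : mixed_eval tX = mixed_x k.
Proof.
rewrite /mixed_eval mmapU /= scale1r mul1r.
by rewrite /word_val fmU big_seq1.
Qed.

Lemma mixed_evalY : mixed_eval tY = mixed_y k.
Proof.
rewrite /mixed_eval mmapU /= scale1r mul1r.
by rewrite /word_val fmU big_seq1.
Qed.

Lemma mixed_eval_surj (a : mixed k) : exists t, mixed_eval t = a.
Proof. by exists (mixed_lift tX tY a); apply: mixed_liftK mixed_evalX mixed_evalY a. Qed.

Lemma mixed_ker t : mixed_eval t = 0 <-> two_sided_ideal (rels tX tY) t.
Proof. exact: eval_kernel mixed_evalX mixed_evalY tensor_ind t. Qed.

Lemma rels_deg t : rels tX tY t -> homog 2 t \/ homog 3 t.
Proof.
have XM u v : homog 1 u -> homog 1 v -> homog 2 (u * v : T) by exact: homogM.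
have X1 : homog 1 tX := @homog_letter k 2 ord0.
have Y1 : homog 1 tY := @homog_letter k 2 ord_max.
case=> ->; left; first exact: XM X1 Y1.
exact: homogD (XM _ _ Y1 X1) (homogN (XM _ _ X1 X1)).
Qed.

Lemma mcoeffMletter (t : T) i : mcoeff mone (t * << fmu i >>) = 0.
Proof. by rewrite [mcoeff _ _]rmorphM /= mcoeffU1 fm1_eq1 mulr0. Qed.

Lemma mixed_augE (t : T) : mixed_aug (mixed_eval t) = mcoeff mone t.
Proof.
elim/tensor_ind: t => [|c t t' IHt IHt'||t _|t _].
- by rewrite raddf0 mcoeff0 /mixed_aug coef0.
- rewrite [mixed_eval _]linearP mcoeffD mcoeffZ -IHt -IHt'.
  by rewrite /mixed_aug !coordE coefD coefZ.
- by rewrite rmorph1 mcoeff1 eqxx /mixed_aug coef1.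
- by rewrite mcoeffMletter [mixed_eval _]rmorphM /= mixed_evalX mixed_mulx /mixed_aug coef0.
- by rewrite mcoeffMletter [mixed_eval _]rmorphM /= mixed_evalY mixed_muly /mixed_aug coefMX.
Qed.

(** With [d = 3], the least value above 2, [delta] has slope [3/2]; this exceeds the slope [4/3]
    that bounds the growth of internal degrees in the resolution below. *)
Definition mixed_ga : graded_alg k 3 :=
  @GradedAlg k 3 (mixed k) 2 (@mixed_eval k) (rels tX tY) mixed_eval_surj
    mixed_ker rels_deg (@mixed_aug k) mixed_augE.
End Presentation.

(** * Graded pieces of [C] *)

Section Pieces.
Variable k : fieldType.
Local Notation A := (mixed_ga k).
Local Notation T := (tensor_alg k 2).
Implicit Types a b : A.

(** The value of a word of length [i] is fixed by [hcomp i]; conversely the normal form of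
    [hcomp i a] is a homogeneous tensor. *)
Lemma piece_hcomp i a : ga_piece i a <-> hcomp i a = a.
Proof.
split=> [[t ti <-]|<-].
  rewrite /= /mixed_eval mmapE raddf_sum big_seq [RHS]big_seq.
  apply: eq_bigr => w wt /=; rewrite -scalerAl mul1r linearZ /=; congr (_ *: _).
  by rewrite /word_val hcomp_word -(ti w wt) eqxx.
exists (mixed_lift (tX k) (tY k) (hcomp i a)); last first.
  exact: mixed_liftK (mixed_evalX k) (mixed_evalY k) _.
have X1 : homog 1 (tX k) := @homog_letter k 2 ord0.
have Y1 : homog 1 (tY k) := @homog_letter k 2 ord_max.
rewrite /mixed_lift /=; apply: homogD; first apply: homogD.
- rewrite map_polyZ map_polyXn hornerZ hornerXn -scalerAl mul1r.
  exact/homogZ/homogX.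
- by case: eqP => [->|_]; [apply: homogZ | rewrite scale0r; apply: homog0].
- case: eqP => [->|_]; last by rewrite scale0r; apply: homog0.
  exact/homogZ/(@homogM _ _ 1 1).
Qed.
End Pieces.

(** * Linear maps, projective modules and lifting *)

Section LinearMaps.
Variable A : nzRingType.

Definition rmul (h : A) (a : A^o) : A^o := (a : A) * h.
Fact rmul_linear h : linear (rmul h).
Proof. by move=> c a b; rewrite /rmul mulrDl /GRing.scale /= mulrA. Qed.
HB.instance Definition _ h := GRing.isLinear.Build A A^o A^o _ (rmul h) (rmul_linear h).

Definition rmul2 (h1 h2 : A) (p : A^o * A^o) : A^o := rmul h1 p.1 + rmul h2 p.2.
Fact rmul2_linear h1 h2 : linear (rmul2 h1 h2).
Proof.
by move=> c p q; rewrite /rmul2 /= !linearP addrACA scalerDr.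
Qed.
HB.instance Definition _ h1 h2 :=
  GRing.isLinear.Build A (A^o * A^o)%type A^o _ (rmul2 h1 h2) (rmul2_linear h1 h2).

Definition prod_map (M M' N N' : lmodType A)
  (f : {linear M -> M'}) (g : {linear N -> N'}) (p : M * N) : M' * N' := (f p.1, g p.2).
Fact prod_map_linear (M M' N N' : lmodType A) f g : linear (@prod_map M M' N N' f g).
Proof. by move=> c p q; rewrite /prod_map /= !linearP. Qed.
HB.instance Definition _ (M M' N N' : lmodType A) f g :=
  GRing.isLinear.Build A (M * N)%type (M' * N')%type _ (@prod_map M M' N N' f g)
    (prod_map_linear f g).

Definition inl_map (M N : lmodType A) (u : M) : M * N := (u, 0).
Arguments inl_map {M} N u.
Fact inl_map_linear (M N : lmodType A) : linear (@inl_map M N).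
Proof. by move=> c u v; congr (_, _); rewrite /= scaler0 addr0. Qed.
HB.instance Definition _ (M N : lmodType A) :=
  GRing.isLinear.Build A M (M * N)%type _ (@inl_map M N) (@inl_map_linear M N).

Definition inr_map (M N : lmodType A) (u : N) : M * N := (0, u).
Arguments inr_map M {N} u.
Fact inr_map_linear (M N : lmodType A) : linear (@inr_map M N).
Proof. by move=> c u v; congr (_, _); rewrite /= scaler0 addr0. Qed.
HB.instance Definition _ (M N : lmodType A) :=
  GRing.isLinear.Build A N (M * N)%type _ (@inr_map M N) (@inr_map_linear M N).

Definition smul_map (M : lmodType A) (u : M) (a : A^o) : M := (a : A) *: u.
Fact smul_map_linear (M : lmodType A) (u : M) : linear (smul_map u).
Proof. by move=> c a b; rewrite /smul_map scalerDl scalerA. Qed.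
HB.instance Definition _ (M : lmodType A) (u : M) :=
  GRing.isLinear.Build A A^o M _ (smul_map u) (smul_map_linear u).


Lemma projective_regular : projective (A^o : lmodType A).
Proof.
move=> M N g f g_surj; have [u gu] := g_surj (f 1).
exists (smul_map u : {linear A^o -> M}) => a.
by rewrite /= /smul_map linearZ /= gu -linearZ /= /GRing.scale /= mulr1.
Qed.

Lemma projective_prod (P Q : lmodType A) :
  projective P -> projective Q -> projective (P * Q : lmodType A)%type.
Proof.
move=> Pproj Qproj M N g f g_surj.
have [hP hPE] := Pproj M N g (f \o inl_map Q : {linear P -> N}) g_surj.
have [hQ hQE] := Qproj M N g (f \o inr_map P : {linear Q -> N}) g_surj.
exists ((hP \o fst) \+ (hQ \o snd) : {linear (P * Q)%type -> M}) => -[p q] /=.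
rewrite linearD /= hPE hQE /= -linearD /=; congr (f _).
by rewrite /inl_map /inr_map; congr (_, _); rewrite ?addr0 ?add0r.
Qed.

Section Kernel.
Variables (U V : lmodType A) (f : {linear U -> V}).

(** The kernel becomes a module of its own; for a difference of two maps, one on each factor of a
    product, it is their pullback. *)
Definition ker_pred : {pred U} := [pred u | f u == 0].

Fact ker_pred_submod_closed : submod_closed ker_pred.
Proof.
split=> [|c u w]; first by rewrite inE linear0.
by rewrite !inE linearP => /eqP -> /eqP ->; rewrite scaler0 addr0.
Qed.
HB.instance Definition _ := GRing.isSubmodClosed.Build A U ker_pred ker_pred_submod_closed.

Record ker_sub := KerSub { ker_val :> U; _ : ker_val \in ker_pred }.
HB.instance Definition _ := [isSub for ker_val].
HB.instance Definition _ := [Choice of ker_sub by <:].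
HB.instance Definition _ := [SubChoice_isSubLmodule of ker_sub by <:].
End Kernel.

(* The pullback of [p] along [f] surjects onto [P]; a section of it gives [h]. *)
Lemma projective_lift (P M N : lmodType A) (p : {linear M -> N}) (f : {linear P -> N}) :
  projective P -> (forall w, exists m, p m = f w) ->
  exists h : {linear P -> M}, forall w, p (h w) = f w.
Proof.
move=> Pproj pf; pose q : {linear (P * M)%type -> N} := (f \o fst) \- (p \o snd).
pose pr1 : {linear ker_sub q -> P} := fst \o \val.
have pr1_surj w : exists t, pr1 t = w.
  have [m pm] := pf w; have wm : (w, m) \in ker_pred q by rewrite inE /= pm subrr.
  by exists (KerSub wm).
have [h hE] := Pproj _ _ pr1 (idfun : {linear P -> P}) pr1_surj.
exists (snd \o (\val \o h) : {linear P -> M}) => w.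
have := valP (h w); rewrite inE /= subr_eq0 => /eqP <-.
by have /= -> := hE w.
Qed.

(** * The resolution by paths and its exactness *)

Section Tower.
Variables x y z v : A.

(* [NK, NX, NY, NZ] stand for the modules k, Ax, Ay, Az, and [tower n s] is the n-th
   term of the resolution of [s]: a copy of [A] for each path of length [n] from [s]. *)
Inductive node := NK | NX | NY | NZ.

Fixpoint tower (n : nat) (s : node) : lmodType A :=
  if n is n'.+1 then
    match s with
    | NK => (tower n' NX * tower n' NY)%type
    | NX => tower n' NZ
    | NY => tower n' NX
    | NZ => tower n' NK
    end
  else A^o.

(** The recursion follows the first arrow of a path, and the base case supplies the coefficients:
    the differential removes the last arrow and multiplies on the right by its label. *)
Fixpoint tower_d (n : nat) : forall s, {linear tower n.+1 s -> tower n s} :=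
  match n return forall s, {linear tower n.+1 s -> tower n s} with
  | 0 => fun s => match s return {linear tower 1 s -> tower 0 s} with
    | NK => rmul2 x y
    | NX => rmul z
    | NY => rmul x
    | NZ => rmul v
    end
  | n'.+1 => fun s => match s return {linear tower n'.+2 s -> tower n'.+1 s} with
    | NK => prod_map (tower_d n' NX) (tower_d n' NY)
    | NX => tower_d n' NZ
    | NY => tower_d n' NX
    | NZ => tower_d n' NK
    end
  end.

Lemma tower_projective n s : projective (tower n s).
Proof.
elim: n s => [|n IHn] [] //=; try exact: projective_regular.
exact: projective_prod.
Qed.

Hypotheses
  (ann_x : forall a : A, a * x = 0 <-> exists b, b * z = a)
  (ann_y : forall a : A, a * y = 0 <-> exists b, b * x = a)
  (ann_z : forall a : A, a * z = 0 <-> exists b, b * v = a)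
  (ann_v : forall a : A, a * v = 0 <-> exists b c, b * x + c * y = a)
  (xy_direct : forall a b : A, a * x + b * y = 0 -> a * x = 0 /\ b * y = 0).

(** Since the differential leaves the first arrow alone, induction strips arrows until [n = 0],
    where exactness is the description of the annihilators. *)
Lemma tower_exact n s (u : tower n.+1 s) :
  tower_d n s u = 0 <-> exists w, tower_d n.+1 s w = u.
Proof.
elim: n s u => [|n IHn] [].
- case=> a b; split=> [/xy_direct [/= /ann_x [a' <-] /ann_y [b' <-]]|].
    by exists (a', b').
  case=> -[a' b'] [<- <-]; rewrite /= /rmul2 /rmul /=.
  have -> : a' * z * x = 0 by apply/ann_x; exists a'.
  by rewrite add0r; apply/ann_y; exists b'.
- exact: ann_z.
- exact: ann_x.
- move=> a; split=> [/ann_v [b [c <-]]|[[b c] <-]]; first by exists (b, c).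
  by apply/ann_v; exists b, c.
- case=> a b; split=> [[/= /IHn [a' <-] /IHn [b' <-]]|]; first by exists (a', b').
  by case=> -[a' b'] [<- <-]; congr (_, _); apply/IHn; [exists a' | exists b'].
- exact: (IHn NZ).
- exact: (IHn NX).
- exact: (IHn NK).
Qed.

End Tower.
End LinearMaps.
Arguments inl_map {A M} N u.
Arguments inr_map {A} M {N} u.

(** * Gradings of products, shifts and the regular module *)

Section Gradings.
Variables (k : fieldType) (d : nat) (C : graded_alg k d).

Lemma grading_span (M : lmodType C) gr (u : M) : is_grading gr ->
  exists (s : seq int) (y : int -> M), [/\ uniq s, forall j, gr j (y j),
    forall j, j \notin s -> y j = 0 & u = \sum_(j <- s) y j].
Proof.
move=> grP; have [s [y [yP ->]]] := gr_span grP u.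
(* A degree repeated in [s] contributes [y j] once per occurrence, so multiplicities move into the
   summands; they also make the summands vanish outside [s]. *)
exists (undup s), (fun j => y j *+ count_mem j s); split; first exact: undup_uniq.
- move=> j; elim: (count_mem _ _) => [|m IHm]; first by rewrite mulr0n; exact: gr_zero grP _.
  by rewrite mulrS; apply: gr_add grP _ _ _ (yP j) IHm.
- by move=> j; rewrite mem_undup => /count_memPn ->; rewrite mulr0n.
- by rewrite big_undup_iterop_count; apply: eq_bigr.
Qed.

Lemma grading_prod (M N : lmodType C) grM grN :
  is_grading (M := M) grM -> is_grading (M := N) grN ->
  is_grading (M := (M * N)%type) (fun j p => grM j p.1 /\ grN j p.2).
Proof.
move=> MP NP; split.
- by move=> j; split; [exact: gr_zero MP _ | exact: gr_zero NP _].
- by move=> j p q [p1 p2] [q1 q2]; split;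
    [exact: gr_add MP _ _ _ p1 q1 | exact: gr_add NP _ _ _ p2 q2].
- by move=> i j a p ai [p1 p2]; split;
    [exact: gr_scale MP _ _ _ _ ai p1 | exact: gr_scale NP _ _ _ _ ai p2].
- case=> u w; have [s [f [us fP f0 ->]]] := grading_span u MP.
  have [t [g [ut gP g0 ->]]] := grading_span w NP.
  (* Each family vanishes off its own support, so both sums extend to the union of the supports. *)
  exists (undup (s ++ t)), (fun j => (f j, g j)); split=> //.
  have pairE (r : seq int) : \sum_(j <- r) (f j, g j) = (\sum_(j <- r) f j, \sum_(j <- r) g j).
    by elim: r => [|j r IHr]; rewrite ?big_nil // !big_cons IHr.
  rewrite pairE; congr (_, _).
    rewrite [RHS](bigID (mem s)) /= [X in _ + X]big1 ?addr0; last by move=> i; apply: f0.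
    rewrite -[RHS]big_filter; apply: perm_big; apply: uniq_perm => //.
      exact/filter_uniq/undup_uniq.
    by move=> i; rewrite mem_filter mem_undup mem_cat /=; case: (i \in s).
  rewrite [RHS](bigID (mem t)) /= [X in _ + X]big1 ?addr0; last by move=> i; apply: g0.
  rewrite -[RHS]big_filter; apply: perm_big; apply: uniq_perm => //.
    exact/filter_uniq/undup_uniq.
  by move=> i; rewrite mem_filter mem_undup mem_cat /=; case: (i \in t); rewrite ?orbT.
- move=> s y us yP sum0 j js.
  have fst0 : \sum_(i <- s) (y i).1 = 0.
    by rewrite -(raddf_sum (fst : {linear (M * N)%type -> M})) /= sum0.
  have snd0 : \sum_(i <- s) (y i).2 = 0.
    by rewrite -(raddf_sum (snd : {linear (M * N)%type -> N})) /= sum0.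
  rewrite [y j]surjective_pairing; congr (_, _).
    exact: (gr_indep MP us (fun i => (yP i).1) fst0 js).
  exact: (gr_indep NP us (fun i => (yP i).2) snd0 js).
Qed.

Lemma grading_shift (M : lmodType C) gr (m : int) :
  is_grading gr -> is_grading (M := M) (fun j => gr (j - m)).
Proof.
move=> grP; split.
- by move=> j; apply: gr_zero grP _.
- by move=> j; apply: gr_add grP _.
- by move=> i j a u ai uj; rewrite -addrA; apply: gr_scale grP _ _ _ _ ai uj.
- move=> u; have [s [y [yP ->]]] := gr_span grP u.
  exists [seq j + m | j <- s], (fun j => y (j - m)); split=> [j|]; first exact: yP.
  by rewrite big_map; apply: eq_bigr => j _; rewrite addrK.
- move=> s y us yP sum0 j js.
  have := @gr_indep _ _ _ _ _ grP [seq i - m | i <- s] (fun i => y (i + m)).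
  rewrite map_inj_uniq //; last exact: addIr.
  move=> /(_ us) h; rewrite -[j](subrK m); apply: h.
  + by move=> i; rewrite -{1}[i](addrK m); apply: yP.
  + by rewrite big_map -[RHS]sum0; apply: eq_bigr => i _; rewrite subrK.
  + exact: map_f.
Qed.

Definition reg_gr (j : int) (a : C^o) : Prop :=
  if j is Posz i then ga_piece i a else a = 0.

Lemma piece0 i : ga_piece i (0 : C).
Proof. by exists 0; [exact: homog0 | rewrite raddf0]. Qed.

Lemma pieceM i j (a b : C) : ga_piece i a -> ga_piece j b -> ga_piece (i + j) (a * b).
Proof.
move=> [t ti <-] [u uj <-]; exists (t * u); first exact: homogM.
by rewrite rmorphM.
Qed.

Lemma pieceD i (a b : C) : ga_piece i a -> ga_piece i b -> ga_piece i (a + b).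
Proof.
move=> [t ti <-] [u uj <-]; exists (t + u); first exact: homogD.
by rewrite rmorphD.
Qed.

Lemma piece_aug i (a : C) : ga_piece i a -> ga_aug C a != 0 -> i = 0.
Proof.
move=> [t ti <-]; rewrite ga_augE mcoeff_neq0 => /ti.
by rewrite fdeg1.
Qed.

Lemma reg_gr0 j : reg_gr j 0.
Proof. by case: j => // i; apply: piece0. Qed.

Lemma reg_grD j a b : reg_gr j a -> reg_gr j b -> reg_gr j (a + b).
Proof.
case: j => i /=; first exact: pieceD.
by move=> -> ->; rewrite addr0.
Qed.

Lemma reg_grM (j : int) (m : nat) (a h : C) :
  ga_piece m h -> reg_gr (j - m%:Z) a -> reg_gr j (a * h).
Proof.
rewrite -{2}[j](subrK m%:Z); case: (j - m%:Z) => i hm /=.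
  by move=> ai; apply: pieceM.
move=> ->; rewrite mul0r; apply: reg_gr0.
Qed.

Lemma reg_grMl (i : nat) (j : int) (a b : C) :
  ga_piece i a -> reg_gr j b -> reg_gr (i%:Z + j) (a * b).
Proof.
case: j => j ai /= bj; first exact: pieceM.
by rewrite bj mulr0; apply: reg_gr0.
Qed.

End Gradings.

(** * The graded resolution of [k], with [x, y, z, v] in the roles of [x, y, x - y, x^2] *)

Section PeriodicResolution.
Variables (k : fieldType) (C : graded_alg k 3) (x y z v : C).
Local Notation A := (ga_alg C : nzRingType).
Local Notation Q := (tower A).
Local Notation K := (trivmod C : lmodType C).

Hypotheses (x1 : ga_piece 1 x) (y1 : ga_piece 1 y) (z1 : ga_piece 1 z) (v2 : ga_piece 2 v).
Hypothesis reg_grading : is_grading (M := (C^o : lmodType C)) (@reg_gr k 3 C).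
Hypotheses
  (ann_x : forall a : C, a * x = 0 <-> exists b, b * z = a)
  (ann_y : forall a : C, a * y = 0 <-> exists b, b * x = a)
  (ann_z : forall a : C, a * z = 0 <-> exists b, b * v = a)
  (ann_v : forall a : C, a * v = 0 <-> ga_aug C a = 0)
  (aug_ideal : forall a : C, ga_aug C a = 0 <-> exists b c, b * x + c * y = a)
  (xy_direct : forall a b : C, a * x + b * y = 0 -> a * x = 0 /\ b * y = 0).

Local Notation dQ := (tower_d x y z v).

Lemma ann_v_span (a : C) : a * v = 0 <-> exists b c, b * x + c * y = a.
Proof. by rewrite ann_v aug_ideal. Qed.

Definition aug_map (a : C^o) : K := ga_aug C a.
Fact aug_map_linear : linear aug_map.
Proof. by move=> c a b; rewrite /aug_map rmorphD rmorphM. Qed.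
HB.instance Definition _ := GRing.isLinear.Build C C^o K _ aug_map aug_map_linear.

Lemma aug_map_exact (a : Q 0 NK) : aug_map a = 0 <-> exists b, dQ 0 NK b = a.
Proof.
split=> [/aug_ideal [b [c <-]]|[[b c] <-]]; first by exists (b, c).
by apply/aug_ideal; exists b, c.
Qed.

Lemma aug_scalar (c : k) : ga_aug C (c *: 1) = c.
Proof.
by rewrite -(rmorph1 (ga_pi C)) -linearZ ga_augE mcoeffZ mcoeff1 eqxx mulr1.
Qed.

Lemma aug_map_surj (m : K) : exists a, aug_map a = m.
Proof. by exists ((m : k) *: 1 : C); apply: aug_scalar. Qed.

Definition per_resolution : resolution K :=
  @Resolution A K (fun n => Q n NK) (fun n => dQ n NK) aug_map
    (fun n => @tower_projective A n NK) aug_map_surj aug_map_exact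
    (fun n => @tower_exact A x y z v ann_x ann_y ann_z ann_v_span xy_direct n NK).

(** The generator of a path sits in the total degree of its arrows, which makes the differentials
    homogeneous of degree 0. *)
Fixpoint tower_gr (n : nat) : forall s, int -> Q n s -> Prop :=
  match n return forall s, int -> Q n s -> Prop with
  | 0 => fun s => @reg_gr k 3 C
  | n'.+1 => fun s => match s return int -> Q n'.+1 s -> Prop with
    | NK => fun j u => tower_gr (s := NX) (j - 1) u.1 /\ tower_gr (s := NY) (j - 1) u.2
    | NX => fun j => tower_gr (s := NZ) (j - 1)
    | NY => fun j => tower_gr (s := NX) (j - 1)
    | NZ => fun j => tower_gr (s := NK) (j - 2)
    end
  end.

Lemma tower_grP n s : is_grading (C := C) (@tower_gr n s).
Proof.
elim: n s => [|n IHn] []; try exact: reg_grading.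
- exact: grading_prod (grading_shift 1 (IHn NX)) (grading_shift 1 (IHn NY)).
- exact: grading_shift 1 (IHn NZ).
- exact: grading_shift 1 (IHn NX).
- exact: grading_shift 2 (IHn NK).
Qed.

Lemma tower_d_deg n s j u : tower_gr (n := n.+1) (s := s) j u -> tower_gr j (dQ n s u).
Proof.
elim: n s j u => [|n IHn] [] j.
- by case=> a b [/= ja jb]; apply: reg_grD; [exact: reg_grM x1 ja | exact: reg_grM y1 jb].
- by move=> a; apply: reg_grM z1.
- by move=> a; apply: reg_grM x1.
- by move=> a; apply: reg_grM v2.
- by case=> a b [/= ja jb]; split; [exact: (IHn NX) | exact: (IHn NY)].
- by move=> a; apply: (IHn NZ).
- by move=> a; apply: (IHn NX).
- by move=> a; apply: (IHn NK).
Qed.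

Lemma aug_deg j (a : C^o) : reg_gr j a -> j != 0 -> aug_map a = 0.
Proof.
case: j => j /=; last by move=> -> _; exact: raddf0.
move=> ja; apply: contra_neq_eq => /piece_aug -/(_ _ ja) -> //.
Qed.

Definition per_gres : graded_resolution C :=
  @GradedResolution k 3 C per_resolution (fun n => @tower_gr n NK) (fun n => tower_grP n NK)
    (fun n j u => @tower_d_deg n NK j u) aug_deg.

(** * Minimality of the resolution and the bound by [delta] *)

Lemma linear_regE (u : {linear C^o -> K}) (a : C^o) : u a = ga_aug C a * (u 1 : k).
Proof. by rewrite -[X in u X]mulr1 -[_ * 1]/(a *: (1 : C^o)) linearZ. Qed.

Lemma linear_pairE (M N L : lmodType C) (u : {linear (M * N)%type -> L}) p :
  u p = u (p.1, 0) + u (0, p.2).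
Proof.
by rewrite -linearD; congr (u _); case: p => a b; congr (_, _); rewrite ?addr0 ?add0r.
Qed.

Lemma piece_aug0 i (a : C) : ga_piece i.+1 a -> ga_aug C a = 0.
Proof. by move=> ai; apply/eqP/negPn/negP => /(piece_aug ai). Qed.

Lemma linear_regM (u : {linear C^o -> K}) i (a h : C) : ga_piece i.+1 h -> u (a * h : C^o) = 0.
Proof. by move=> hi; rewrite linear_regE rmorphM (piece_aug0 hi) mulr0 mul0r. Qed.

(** All labels have positive degree and [u] factors through the augmentation. So [Hom(P, k)] has
    zero differential. *)
Lemma tower_minimal n s (u : {linear Q n s -> K}) w : u (dQ n s w) = 0.
Proof.
elim: n s u w => [|n IHn] [] u w.
- case: w => a b /=; rewrite /rmul2 linearD /rmul.
  by rewrite (linear_regM u _ x1) (linear_regM u _ y1) addr0.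
- exact: linear_regM z1.
- exact: linear_regM x1.
- exact: linear_regM v2.
- rewrite linear_pairE /=.
  have := IHn NX (u \o inl_map _) w.1; have := IHn NY (u \o inr_map _) w.2.
  by rewrite /= /inl_map /inr_map => -> ->; rewrite addr0.
- exact: (IHn NZ).
- exact: (IHn NX).
- exact: (IHn NK).
Qed.

(* At most [(n + excess s) / 3] arrows of degree 2 occur in a path of length [n] from [s]. *)
Definition excess (s : node) : nat := match s with NK | NY => 0 | NX => 1 | NZ => 2 end.

Lemma int_sub_nat (j : int) (i m : nat) : j - i%:Z = m%:Z -> j = (m + i)%:Z.
Proof. by move=> /eqP; rewrite subr_eq => /eqP. Qed.

(** [excess] is a potential: an arrow of degree [i] from [s] to [t] satisfies
    [excess t + 3 i <= 4 + excess s], and these inequalities add up along a path. *)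
Lemma tower_deg n s (u : {linear Q n s -> K}) j w :
  tower_gr j w -> u w != 0 -> exists2 m : nat, j = m%:Z & (3 * m <= 4 * n + excess s)%N.
Proof.
elim: n s u j w => [|n IHn] s u j w.
  case: j => j /=; last by move=> ->; rewrite linear0 eqxx.
  move=> jw uw; exists j => //; rewrite (piece_aug jw) //.
  by apply: contraNneq uw => w0; rewrite linear_regE w0 mul0r.
have step t i (u' : {linear Q n t -> K}) w' : tower_gr (j - i%:Z) w' -> u' w' != 0 ->
    (excess t + 3 * i <= 4 + excess s)%N ->
    exists2 m : nat, j = m%:Z & (3 * m <= 4 * n.+1 + excess s)%N.
  move=> jw' uw' ts; have [m /int_sub_nat -> mn] := IHn _ _ _ _ jw' uw'.
  by exists (m + i)%N => //; lia.
case: s u w step => u w step jw uw.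
- move: uw; rewrite linear_pairE; case: jw => jw1 jw2.
  have [w1|w1 _] := eqVneq (u (w.1, 0)) 0; last first.
    exact: (step NX 1 (u \o inl_map _) w.1 jw1 w1).
  rewrite w1 add0r => w2.
  exact: (step NY 1 (u \o inr_map _) w.2 jw2 w2).
- exact: (step NZ 1 u w jw uw).
- exact: (step NX 1 u w jw uw).
- exact: (step NK 2 u w jw uw).
Qed.

(** At [n = 1] it is the integrality of [m] that brings [4/3] down to [delta 1 = 1]. *)
Lemma deg_le_delta n m : (3 * m <= 4 * n)%N -> (m <= @delta 3 n)%N.
Proof. by rewrite /delta; have := odd_double_half n; lia. Qed.

Lemma per_two_d_determined : two_d_determined per_gres.
Proof.
move=> i j jd f [[_ fi] fj].
(* Not only the class but [f] itself vanishes: its degree [j] exceeds the bound of [tower_deg]. *)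
have f0 i' (w : Q i' NK) : f i' w = 0.
  have [e|/eqP ne] := eqVneq i' i; last exact: fi.
  have [s [g [gP ->]]] := gr_span (tower_grP i' NK) w.
  subst i'; rewrite linear_sum big1 // => j' _.
  have [e|/eqP ne] := eqVneq j' j; last exact: fj (gP j') ne.
  subst j'; apply/eqP/negPn/negP => /(tower_deg (s := NK) (gP j)) [m jm].
  by rewrite addn0 => /deg_le_delta; move: jd; rewrite jm lez_nat => /negP.
exists (fun i => \0 : {linear Q i NK -> K}).
  by exists 0%N => ? ? ? _; rewrite eqxx.
by split=> [w|i' w]; rewrite !f0.
Qed.

(** * Infinite global dimension *)

Hypotheses (zx0 : z * x = 0) (vz0 : v * z = 0) (xv0 : x * v = 0).
Hypotheses
  (aug_xy : forall a b c : C, a * x + b * y = x * c -> ga_aug C a = ga_aug C c)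
  (aug_z : forall a c : C, a * z = z * c -> ga_aug C a = ga_aug C c)
  (aug_v : forall a c : C, a * v = v * c -> ga_aug C a = ga_aug C c).

(* [label] and [lead] follow the paths going round the loop k -> Cx -> C(x - y) -> k. *)
Fixpoint label (n : nat) (s : node) : C :=
  match n, s with
  | 0, NK | 0, NY => x
  | 0, NX => z
  | 0, NZ => v
  | n'.+1, NK | n'.+1, NY => label n' NX
  | n'.+1, NX => label n' NZ
  | n'.+1, NZ => label n' NK
  end.

Fixpoint lead (n : nat) : forall s, Q n s -> C :=
  match n return forall s, Q n s -> C with
  | 0 => fun s a => a
  | n'.+1 => fun s => match s return Q n'.+1 s -> C with
    | NK => fun u => lead (s := NX) u.1
    | NX => fun u => lead (s := NZ) u
    | NY => fun u => lead (s := NX) u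
    | NZ => fun u => lead (s := NK) u
    end
  end.

Lemma lead0 n s : lead (0 : Q n s) = 0.
Proof. by elim: n s => [|n IHn] [] //=. Qed.

Lemma label_mul n s : label n.+1 s * label n s = 0.
Proof.
elim: n s => [|n IHn] []; [exact: zx0 | exact: vz0 | exact: zx0 | exact: xv0 | ..].
- exact: (IHn NX).
- exact: (IHn NZ).
- exact: (IHn NX).
- exact: (IHn NK).
Qed.

(** Reading the equation along the distinguished path leaves, at depth 0, one of [aug_xy], [aug_z],
    [aug_v]. This carries the value 1 of the leading coefficient from one degree to the next. *)
Lemma lead_step n s (w : Q n.+1 s) (w' : Q n s) :
  dQ n s w = label n s *: w' -> ga_aug C (lead w) = ga_aug C (lead w').
Proof.
elim: n s w w' => [|n IHn] [].
- by case=> a b c; apply: aug_xy.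
- exact: aug_z.
- by move=> a c e; apply: (@aug_xy a 0 c); rewrite mul0r addr0.
- exact: aug_v.
- by move=> [a b] [a' b'] [e _]; apply: (IHn NX a a').
- exact: (IHn NZ).
- exact: (IHn NX).
- exact: (IHn NK).
Qed.

(** In degree 0 the augmentation serves as differential, so that the induction of [resolution_long]
    is uniform. *)
Definition is_cycle (M : lmodType A) (R : resolution M) (n : nat) : R n -> Prop :=
  match n return R n -> Prop with
  | 0 => fun u => res_aug R u = 0
  | n'.+1 => fun u => res_d R n' u = 0
  end.

Lemma cycle_boundary (M : lmodType A) (R : resolution M) n (u : R n) :
  is_cycle u <-> exists w, res_d R n w = u.
Proof. by case: n u => [|n] u; [apply: res_exact0 | apply: res_exact]. Qed.

(* The elements [r_n] with [d r_(n+1) = label n *: r_n] exist in every resolution [R] of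
   the trivial module, and a chain map from [R] shows that none of them vanishes. *)
Lemma resolution_long (R : resolution K) n : exists (r : R n) (g : {linear R n -> Q n NK}),
  [/\ is_cycle (label n NK *: r), forall u, is_cycle u -> is_cycle (R := per_resolution) (g u)
    & ga_aug C (lead (g r)) = 1].
Proof.
elim: n => [|n [r [g [rc gc gr]]]].
  have [r r1] := res_aug_surj R (1 : k).
  have [g gE] := @res_proj A K R 0 _ _ aug_map (res_aug R) aug_map_surj.
  exists r, g; split.
  - by rewrite /= linearZ /= r1 /GRing.scale /= /triv_scale (piece_aug0 x1) mul0r.
  - by move=> u /= <-; apply: gE.
  - by have := gE r; rewrite r1.
have [r' r'E] := (cycle_boundary _).1 rc.
have gd w : exists m, dQ n NK m = g (res_d R n w).
  by apply/(cycle_boundary (R := per_resolution))/gc/cycle_boundary; exists w.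
have [g' g'E] := @projective_lift A _ _ _ (dQ n NK)
  (g \o res_d R n) (@res_proj A K R n.+1) gd.
exists r', g'; split.
(* Consecutive labels multiply to 0, so the new multiple is again a cycle and has a preimage in the
   next degree. *)
- by rewrite /is_cycle linearZ_LR r'E scalerA label_mul scale0r.
- by move=> u /= u0; rewrite g'E /= u0 linear0.
- by rewrite (@lead_step n NK _ (g r)) // g'E /= r'E linearZ.
Qed.

(** In a resolution of [k] that vanishes beyond degree [n], the element [r] of degree [n + 1] would
    be 0, against its leading coefficient 1. *)
Lemma per_infinite_gldim : infinite_gldim A.
Proof.
move=> n /(_ K) [R R0]; have [r [g [_ _]]] := resolution_long R n.+1.
rewrite (R0 n.+1 (ltnSn n) r) linear0 lead0 rmorph0 => /esym/eqP.
by rewrite oner_eq0.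
Qed.

(** * A functional that vanishes on all products from [E^1] and [E^2] *)

Hypotheses
  (aug_x_v : forall a b : C, a * x = v * b -> ga_aug C a = 0)
  (aug_z_v : forall a b : C, a * z = v * b -> ga_aug C a = 0)
  (aug_xy_v : forall a b c : C, a * x + b * y = v * c -> ga_aug C a = 0 /\ ga_aug C b = 0).

Local Notation P := per_gres.
Local Notation family := (hom_family P).

(** The basis elements of the path [NK -> NX -> NZ] and, for [e3], of the loop that continues it to
    [NK]. *)
Definition e2 : Q 2 NK := ((1 : C^o, 0) : Q 1 NX * Q 1 NY).
Definition e3 : Q 3 NK := ((1 : C^o, 0) : Q 2 NX * Q 2 NY).

Lemma dQ_e3 : dQ 2 NK e3 = v *: e2.
Proof.
rewrite /= /prod_map /e3 /e2 /= linear0; congr (_, _); last by rewrite scaler0.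
by rewrite /rmul mul1r /GRing.scale /= mulr1.
Qed.

Lemma linear_pair0 (M N : lmodType C) (u : {linear (M * N)%type -> K}) p :
  u (inl_map N p.1) = 0 -> u (inr_map M p.2) = 0 -> u p = 0.
Proof. by rewrite /inl_map /inr_map => h1 h2; rewrite linear_pairE h1 h2 addr0. Qed.

Lemma linear_reg0 (u : {linear C^o -> K}) (a : C^o) : ga_aug C a = 0 -> u a = 0.
Proof. by rewrite linear_regE => ->; rewrite mul0r. Qed.

Lemma linear_vanish1 (u : {linear Q 1 NK -> K}) w (c : Q 0 NK) : dQ 0 NK w = v *: c -> u w = 0.
Proof.
case: w => a b /aug_xy_v [a0 b0]; apply: linear_pair0.
  exact: (linear_reg0 (u \o inl_map _)).
exact: (linear_reg0 (u \o inr_map _)).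
Qed.

Lemma linear_vanish2 (u : {linear Q 2 NK -> K}) w (c : Q 1 NK) : dQ 1 NK w = v *: c -> u w = 0.
Proof.
case: w c => a b [c1 c2] [/aug_z_v a0 /aug_x_v b0]; apply: linear_pair0.
  exact: (linear_reg0 (u \o inl_map _)).
exact: (linear_reg0 (u \o inr_map _)).
Qed.

(** The path of [e3] ends with the arrow labelled [v], so its coefficient is unconstrained;
    [u e3 = 0] takes care of it. *)
Lemma linear_vanish3 (u : {linear Q 3 NK -> K}) w (c : Q 2 NK) :
  u e3 = 0 -> dQ 2 NK w = v *: c -> u w = 0.
Proof.
move=> ue; case: w c => a b [c1 c2] [_ /aug_z_v b0]; apply: linear_pair0.
  have := linear_regE (u \o inl_map _ : {linear C^o -> K}) a.
  by rewrite /= -[inl_map _ 1]/e3 ue mulr0.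
exact: (linear_reg0 (u \o inr_map _)).
Qed.

(* As [d e3 = v e2], a lift sends [e3] to an element [w] with [d w] a multiple of [v],
   and the coefficients of such a [w] lie in the augmentation ideal, except at the
   paths ending with the arrow of degree 2. *)
Lemma generated_vanish (S : family -> Prop) (f : family) :
  (forall g, S g -> g 3 e3 = 0) -> generated S f -> f 3 e3 = 0.
Proof.
move=> S0; elim=> {f} [f /S0 //|f [_ f0] _|c f g h _ f0 _ g0 hE _|f g h _ f0 _ g0|f h _ f0].
- exact: f0.
- by have /= := hE 3 e3; rewrite f0 g0 mulr0 addr0.
- move=> [phi [phi0 phid] hE] _; rewrite hE !big_ord_recl big_ord0 /=.
  have step i : dQ i NK (phi 3 i.+1 e3) = v *: phi 2 i e2.
    by have /= -> := phid 2 i e3; rewrite -linearZ /=; congr (phi 2 i _); apply: dQ_e3.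
  rewrite (linear_vanish1 _ (step 0)) (linear_vanish2 _ (step 1)).
  rewrite (linear_vanish3 f0 (step 2)) !addr0.
  (* In the remaining term [i = 0], the lift sends [e3] to an element with augmentation
     [g 3 e3 = 0]. *)
  apply: (@linear_reg0 (f 0)).
  by have /= := phi0 3 e3; rewrite g0.
(* By minimality, coboundaries vanish on [e3]. *)
- move=> [u _ [_ uE]] _; have := uE 2 e3; rewrite f0 (tower_minimal (s := NK)).
  by rewrite addr0.
Qed.

(** * Finite generation of the Yoneda algebra *)

Definition transport (n i : nat) (e : n = i) : {linear Q n NK -> Q i NK} :=
  match e in _ = i return {linear Q n NK -> Q i NK} with erefl => idfun end.

(** The identity chain map, extended by 0 to all pairs [(n, i)] as the format of [lifts]
    requires. *)
Definition diag (n i : nat) : {linear Q n NK -> Q i NK} :=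
  match @eqP nat n i with
  | ReflectT e => transport e
  | ReflectF _ => \0
  end.

Lemma diag_same n u : diag n n u = u.
Proof. by rewrite /diag; case: eqP => // e; rewrite (eq_axiomK e). Qed.

Lemma diag_neq n i u : n <> i -> diag n i u = 0.
Proof. by rewrite /diag; case: eqP. Qed.

Lemma diag_d n i u : dQ i NK (diag n.+1 i.+1 u) = diag n i (dQ n NK u).
Proof.
have [e|/eqP ni] := eqVneq n i; first by subst i; rewrite !diag_same.
by rewrite !diag_neq ?linear0 // => -[].
Qed.

Definition scale_add (M : lmodType C) (c : k) (f g : {linear M -> K}) (u : M) : K :=
  c * (f u : k) + (g u : k).
Fact scale_add_linear (M : lmodType C) c f g : linear (@scale_add M c f g).
Proof.
have lin (h : {linear M -> K}) a u w :
    (h (a *: u + w) : k) = ga_aug C a * (h u : k) + (h w : k) by rewrite linearP.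
move=> a u w; rewrite /scale_add !lin.
have E (p q r s t e : k) : e * (p * q + r) + (p * s + t) = p * (e * q + s) + (e * r + t).
  by ring.
exact: E.
Qed.
HB.instance Definition _ (M : lmodType C) c f g :=
  GRing.isLinear.Build C M K _ (@scale_add M c f g) (scale_add_linear c f g).

Definition bounded (B : nat) (f : family) : Prop :=
  forall i, (B <= i)%N -> forall u, f i u = 0.

(** By [tower_deg], a bound on the cohomological degree also bounds the internal one. *)
Lemma bounded_finite_support B f : bounded B f -> finite_support f.
Proof.
move=> fB; exists (B + 4 * B)%N => i j u uj fu.
have iB : (i < B)%N by rewrite ltnNge; apply: contraNN fu => /fB ->.
have [m -> mi] := tower_deg (s := NK) uj fu.
move: mi; rewrite /= addn0; lia.
Qed.

Lemma finite_support_bounded f : finite_support f -> exists B, bounded B f.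
Proof.
move=> [B fB]; exists B.+1 => i Bi u.
have [s [g [gP ->]]] := gr_span (tower_grP i NK) u.
rewrite linear_sum big1 // => j _; apply/eqP/negPn/negP => /(fB _ _ _ (gP j)) [].
by rewrite leqNgt Bi.
Qed.

Lemma bounded_cocycle B f : bounded B f -> cocycle f.
Proof.
by move=> fB; split=> [|i u]; [apply: bounded_finite_support fB | apply: (tower_minimal (s := NK))].
Qed.

Definition concentrated (m : nat) (g : {linear Q m NK -> K}) : family :=
  fun n => g \o diag n m : {linear Q n NK -> K}.

Lemma concentrated_same m g u : concentrated g m u = g u.
Proof. by rewrite /concentrated /= diag_same. Qed.

Lemma concentrated_neq m g n u : n <> m -> @concentrated m g n u = 0.
Proof. by move=> nm; rewrite /concentrated /= diag_neq // linear0. Qed.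

Lemma concentrated_bounded m g : bounded m.+1 (@concentrated m g).
Proof. by move=> i mi u; rewrite concentrated_neq // => e; rewrite e ltnn in mi. Qed.

(** [Q n.+2 NX] computes to [Q n NK], so projecting to the paths through [NX] deletes an initial
    loop of length 3; [loop4] does the same through [NY]. Both commute with the differential, which
    acts at the far end of a path. *)
Definition loop3 (n : nat) : {linear Q n.+3 NK -> Q n NK} :=
  (fst : {linear (Q n.+2 NX * Q n.+2 NY)%type -> Q n.+2 NX}).
Definition loop4 (n : nat) : {linear Q n.+4 NK -> Q n NK} :=
  (snd : {linear (Q n.+3 NX * Q n.+3 NY)%type -> Q n.+3 NY}).

Definition aug0 : {linear Q 0 NK -> K} := aug_map.

(* The component of degree [n - 3] of the chain map that removes the first loop; it
   is 0 unless [n = i + 3]. *)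
Definition lift3 (n i : nat) : {linear P n -> P i} :=
  if n is n'.+3 return {linear Q n NK -> Q i NK} then diag n' i \o loop3 n' else \0.
Definition lift4 (n i : nat) : {linear P n -> P i} :=
  if n is n'.+4 return {linear Q n NK -> Q i NK} then diag n' i \o loop4 n' else \0.

Lemma lift3P : lifts (concentrated (aug0 \o loop3 0)) lift3.
Proof.
split=> [n u|n i u].
- case: n u => [|[|[|[|n]]]] u.
  + by rewrite concentrated_neq //= linear0.
  + by rewrite concentrated_neq //= linear0.
  + by rewrite concentrated_neq //= linear0.
  + by rewrite concentrated_same /= diag_same.
  + by rewrite concentrated_neq //= diag_neq // linear0.
- case: n u => [|[|[|n]]] u; rewrite /= ?linear0 //; last exact: diag_d.
  by rewrite diag_neq ?linear0.
Qed.

Lemma lift4P : lifts (concentrated (aug0 \o loop4 0)) lift4.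
Proof.
split=> [n u|n i u].
- case: n u => [|[|[|[|[|n]]]]] u; last by rewrite concentrated_neq //= diag_neq // linear0.
  + by rewrite concentrated_neq //= linear0.
  + by rewrite concentrated_neq //= linear0.
  + by rewrite concentrated_neq //= linear0.
  + by rewrite concentrated_neq //= linear0.
  + by rewrite concentrated_same /= diag_same.
- case: n u => [|[|[|[|n]]]] u; rewrite /= ?linear0 //; last exact: diag_d.
  by rewrite diag_neq ?linear0.
Qed.

Definition shift3 (f : family) : family := fun n =>
  if n is n'.+3 return {linear Q n NK -> K} then f n' \o loop3 n' else \0.
Definition shift4 (f : family) : family := fun n =>
  if n is n'.+4 return {linear Q n NK -> K} then f n' \o loop4 n' else \0.

Lemma sum_diag (f : family) n m u : (n < m)%N ->
  \sum_(i < m) f i (diag n i u) = f n u.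
Proof.
move=> nm; rewrite (bigD1 (Ordinal nm)) //= diag_same big1 ?addr0 // => i ni.
by rewrite diag_neq ?linear0 // => e; rewrite -val_eqE /= e eqxx in ni.
Qed.

Lemma shift3_mul f : yoneda_mul f (concentrated (aug0 \o loop3 0)) (shift3 f).
Proof.
exists lift3; first exact: lift3P.
case=> [|[|[|n]]] u; try by rewrite big1 // => i _; rewrite linear0.
by apply/esym/sum_diag; lia.
Qed.

Lemma shift4_mul f : yoneda_mul f (concentrated (aug0 \o loop4 0)) (shift4 f).
Proof.
exists lift4; first exact: lift4P.
case=> [|[|[|[|n]]]] u; try by rewrite big1 // => i _; rewrite linear0.
by apply/esym/sum_diag; lia.
Qed.

Lemma shift3_bounded B f : bounded B f -> bounded B.+3 (shift3 f).
Proof. by move=> fB [|[|[|n]]] // Bn u; apply: fB. Qed.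

Lemma shift4_bounded B f : bounded B f -> bounded B.+4 (shift4 f).
Proof. by move=> fB [|[|[|[|n]]]] // Bn u; apply: fB. Qed.

(** The values of [f] on paths beginning with the loop of length 3, that loop being deleted: the
    left factor of this part of [f]. *)
Definition unshift3 (f : family) : family := fun n =>
  (f n.+3 : {linear (Q n.+2 NX * Q n.+2 NY)%type -> K}) \o inl_map _.
Definition unshift4 (f : family) : family := fun n =>
  (f n.+4 : {linear (Q n.+3 NX * Q n.+3 NY)%type -> K}) \o inr_map _.

Definition combine (c : k) (f g : family) : family := fun n => scale_add c (f n) (g n).

Definition aug_fst1 : {linear Q 1 NK -> K} := aug_map \o (fst : {linear (C^o * C^o)%type -> C^o}).
Definition aug_snd1 : {linear Q 1 NK -> K} := aug_map \o (snd : {linear (C^o * C^o)%type -> C^o}).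
Definition aug_fst2 : {linear Q 2 NK -> K} := aug_map \o (fst : {linear (C^o * C^o)%type -> C^o}).
Definition aug_snd2 : {linear Q 2 NK -> K} := aug_map \o (snd : {linear (C^o * C^o)%type -> C^o}).
Definition aug_snd3 : {linear Q 3 NK -> K} := aug_map \o (snd : {linear (C^o * C^o)%type -> C^o}).

(** The first five are dual to the paths from [NK] that do not return, ending through [NX]; [NY];
    [NX, NZ]; [NY, NX]; [NY, NX, NZ]. The last two are dual to the loops. *)
Definition generators : seq family :=
  [:: concentrated aug_fst1; concentrated aug_snd1; concentrated aug_fst2;
      concentrated aug_snd2; concentrated aug_snd3; concentrated (aug0 \o loop3 0);
      concentrated (aug0 \o loop4 0)].

Definition zero_family : family := fun n => \0.

Definition gen_family (l : 'I_7) : family := nth zero_family generators l.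

Lemma gen_family_cocycle l : cocycle (gen_family l).
Proof.
have cc m g : cocycle (@concentrated m g) by apply: bounded_cocycle (concentrated_bounded g).
by case: l => [] [|[|[|[|[|[|[|l]]]]]]] // lt; apply: cc.
Qed.

Definition one_family : family := concentrated aug0.

Lemma one_familyP : yoneda_one one_family.
Proof.
split=> [u|i u]; first by rewrite /one_family concentrated_same.
by rewrite /one_family concentrated_neq.
Qed.

Lemma generated_cocycle (S : family -> Prop) f : generated S f -> cocycle f.
Proof. by case. Qed.

(** Families with equal values are cohomologous through the zero family, which stands in for
    equality of functions. *)
Lemma generated_eqp (S : family -> Prop) (f g : family) :
  generated S f -> (forall n u, f n u = g n u) -> generated S g.
Proof.
move=> fS fg; have [/finite_support_bounded [B fB] _] := generated_cocycle fS.
have gB : bounded B g by move=> i Bi u; rewrite -fg fB.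
apply: (Gen_eq fS) (bounded_cocycle gB).
exists zero_family; first by exists 0 => ? ? ? _; rewrite eqxx.
by split=> [u|i u]; rewrite fg //= addr0.
Qed.

Lemma generated_combine (S : family -> Prop) c (f g : family) :
  generated S f -> generated S g -> generated S (combine c f g).
Proof.
move=> fS gS; have [/finite_support_bounded [B fB] _] := generated_cocycle fS.
have [/finite_support_bounded [B' gB] _] := generated_cocycle gS.
apply: (Gen_lin fS gS (c := c)) => //; apply: (@bounded_cocycle (B + B')) => i Bi u.
rewrite /= /scale_add fB ?gB ?mulr0 ?addr0 //; first exact: leq_trans (leq_addl _ _) Bi.
exact: leq_trans (leq_addr _ _) Bi.
Qed.

Lemma linear_coordE (u : {linear (C^o * C^o)%type -> K}) p :
  u p = ga_aug C p.1 * (u (1, 0) : k) + ga_aug C p.2 * (u (0, 1) : k) :> k.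
Proof.
rewrite linear_pairE; congr (_ + _).
  exact: (linear_regE (u \o inl_map _)).
exact: (linear_regE (u \o inr_map _)).
Qed.

Lemma combineE c (f g : family) n u : (combine c f g n u : k) = c * (f n u : k) + (g n u : k).
Proof. by []. Qed.

(** [(c0 - 1) f0 + f0] encodes [c0 f0], since [combine] always needs a second summand. *)
Lemma combine_sum (c0 c1 c2 c3 c4 c5 : k) (f0 f1 f2 f3 f4 f5 g h : family) n u :
  (combine 1 g (combine 1 h (combine c1 f1 (combine c2 f2 (combine c3 f3
    (combine c4 f4 (combine c5 f5 (combine (c0 - 1) f0 f0))))))) n u : k) =
  (g n u : k) + (h n u : k) + c1 * (f1 n u : k) + c2 * (f2 n u : k) + c3 * (f3 n u : k)
    + c4 * (f4 n u : k) + c5 * (f5 n u : k) + c0 * (f0 n u : k).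
Proof. by rewrite !combineE; ring. Qed.

(** A path of length at least 4 begins with one of the two loops, according to its first arrow.
    Below that, only the loop of length 3 and six shorter or non-returning paths remain; the
    constants are the values of [f] on the latter. *)
Lemma decompose (f : family) : exists c0 c1 c2 c3 c4 c5 : k, forall n u,
    combine 1 (shift3 (unshift3 f)) (combine 1 (shift4 (unshift4 f))
      (combine c1 (concentrated aug_fst1) (combine c2 (concentrated aug_snd1)
      (combine c3 (concentrated aug_fst2) (combine c4 (concentrated aug_snd2)
      (combine c5 (concentrated aug_snd3) (combine (c0 - 1) one_family one_family)))))))
      n u = f n u.
Proof.
exists (f 0 1), (f 1 ((1 : C^o, 0 : C^o) : Q 1 NK)), (f 1 ((0 : C^o, 1 : C^o) : Q 1 NK)),
  (f 2 ((1 : C^o, 0 : C^o) : Q 2 NK)), (f 2 ((0 : C^o, 1 : C^o) : Q 2 NK)),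
  (f 3 ((0 : C^o, 1 : C^o) : Q 3 NK)) => n u.
apply: etrans (combine_sum _ _ _ _ _ _ _ _ _ _ _ _ _ _ _) _; rewrite /one_family.
have same m (g : {linear Q m NK -> K}) w : (concentrated g m w : k) = g w.
  exact: concentrated_same.
have neq m (g : {linear Q m NK -> K}) i w : i != m -> (concentrated g i w : k) = 0.
  by move=> /eqP nm; apply: concentrated_neq.
have s3 i w : (i < 3)%N -> (shift3 (unshift3 f) i w : k) = 0 by case: i w => [|[|[|]]].
have s4 i w : (i < 4)%N -> (shift4 (unshift4 f) i w : k) = 0 by case: i w => [|[|[|[|]]]].
case: n u => [|[|[|[|n]]]] u.
- rewrite s3 // ?s4 // same !neq // !mulr0 !addr0 add0r mulrC.
  exact/esym/(linear_regE (f 0)).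
- rewrite s3 // ?s4 // !same !neq // !mulr0 !addr0 !add0r mulrC [X in _ + X]mulrC.
  exact/esym/(linear_coordE (f 1)).
- rewrite s3 // ?s4 // !same !neq // !mulr0 !addr0 !add0r mulrC [X in _ + X]mulrC.
  exact/esym/(linear_coordE (f 2)).
- rewrite s4 // same !neq // !mulr0 !addr0.
  have -> : (f 3 u : k) = f 3 ((u.1, 0) : Q 3 NK) + f 3 ((0, u.2) : Q 3 NK).
    exact: (linear_pairE (f 3 : {linear (C^o * C^o)%type -> K}) u).
  congr (_ + _); rewrite mulrC.
  exact/esym/(linear_regE ((f 3 : {linear (C^o * C^o)%type -> K}) \o inr_map _)).
- rewrite !neq // !mulr0 !addr0.
  exact/esym/(linear_pairE (f n.+4 : {linear (Q n.+3 NX * Q n.+3 NY)%type -> K})).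
Qed.

Lemma per_fin_gen : yoneda_fin_gen P.
Proof.
exists 7, gen_family; split=> [|f]; first exact: gen_family_cocycle.
set S := (fun g => _); move=> [/finite_support_bounded [B fB] _].
have genS (l : 'I_7) : generated S (gen_family l).
  by apply: Gen_in; [exists l | apply: gen_family_cocycle].
have gen1 : generated S one_family.
  exact: Gen_one one_familyP (bounded_cocycle (concentrated_bounded aug0)).
elim/ltn_ind: B f fB => -[|B] IHB f fB.
  (* With bound 0 the family is zero, obtained as [-1 + 1]. *)
  apply: generated_eqp (generated_combine (-1) gen1 gen1) _ => n u.
  by rewrite (fB n) //; apply: etrans (combineE _ _ _ _) _; rewrite mulN1r addNr.
(* Deleting a loop lowers the bound, so the induction hypothesis covers both left factors. *)
have gf3 : bounded B (unshift3 f) by move=> i Bi u; apply: (fB i.+3); lia.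
have gf4 : bounded B (unshift4 f) by move=> i Bi u; apply: (fB i.+4); lia.
have [c0 [c1 [c2 [c3 [c4 [c5 fE]]]]]] := decompose f.
apply: generated_eqp fE; do ?apply: generated_combine => //.
- apply: Gen_mul (IHB _ _ _ gf3) (genS (@Ordinal 7 5 isT)) (shift3_mul _) _ => //.
  exact: bounded_cocycle (shift3_bounded gf3).
- apply: Gen_mul (IHB _ _ _ gf4) (genS (@Ordinal 7 6 isT)) (shift4_mul _) _ => //.
  exact: bounded_cocycle (shift4_bounded gf4).
- exact: (genS (@Ordinal 7 0 isT)).
- exact: (genS (@Ordinal 7 1 isT)).
- exact: (genS (@Ordinal 7 2 isT)).
- exact: (genS (@Ordinal 7 3 isT)).
- exact: (genS (@Ordinal 7 4 isT)).
Qed.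

(** The class of the loop takes the value 1 on [e3], whereas members of [E^1] and [E^2] have no
    component in degree 3. *)
Lemma per_not_K2 : ~ is_K2 P.
Proof.
have loop_cocycle : cocycle (concentrated (aug0 \o loop3 0)).
  exact: bounded_cocycle (concentrated_bounded _).
move=> /(_ _ loop_cocycle) /generated_vanish h.
have : (concentrated (aug0 \o loop3 0) 3 e3 : k) = 0.
  by apply: h => g [[_ g0]|[_ g0]]; apply: g0.
by rewrite [LHS]concentrated_same /= /aug_map rmorph1 => /eqP; rewrite oner_eq0.
Qed.

End PeriodicResolution.

(** * Verification of the hypotheses for [C] *)

Section Instance.
Variable k : fieldType.
Local Notation C := (mixed_ga k).
Local Notation x := (mixed_x k : C).
Local Notation y := (mixed_y k : C).
Local Notation v := (mixed_xx k : C).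
Implicit Types a b c : mixed k.

Lemma mixed_xmul c : mixed_x k * c = Mixed 0 (cy c)`_0 (cx c).
Proof. by apply: mixedP; rewrite !coordE /= ?coef0 ?mul0r //; ring. Qed.

Lemma mixed_xymul c : (mixed_x k - mixed_y k) * c = Mixed (- ('X * cy c)) (cy c)`_0 0.
Proof.
apply: mixedP; rewrite !coordE /= ?coefD ?coefN ?coefX ?coef0 /= ?sub0r ?mulNr //; ring.
Qed.

Lemma mixed_xxmul c : mixed_xx k * c = Mixed 0 0 (cy c)`_0.
Proof. by apply: mixedP; rewrite !coordE /= ?coef0 ?mul0r //; ring. Qed.

Lemma mixed_reg_grading : is_grading (M := (C^o : lmodType C)) (@reg_gr k 3 C).
Proof.
split; [exact: reg_gr0 | exact: reg_grD | exact: reg_grMl | ..].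
- move=> a; pose N := (3 + size (cy (a : mixed k)))%N.
  exists [seq i%:Z | i <- iota 0 N], (fun j => if j is Posz i then hcomp i (a : mixed k) else 0).
  split=> [[i|i] //=|].
    by apply/piece_hcomp; rewrite hcompK eqxx.
  rewrite big_map -{1}[N]subn0 -[iota _ _]/(index_iota 0 N) big_mkord.
  by rewrite hcomp_sum // ?leq_addr ?leq_addl.
- move=> s f us fP sum0 [] i js; last exact: (fP (Negz i)).
  have fi : hcomp i (f i : mixed k) = f i by apply/piece_hcomp/(fP (Posz i)).
  (* Applying [hcomp i] to the sum isolates its term of degree [i]. *)
  have : hcomp i (\sum_(j <- s) f j : mixed k) = 0 by rewrite sum0 raddf0.
  rewrite raddf_sum (bigD1_seq (Posz i)) //= fi big1 ?addr0 // => -[] j ji.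
    have := fP (Posz j); move=> /piece_hcomp <-; rewrite hcompK.
    by case: (i =P j) ji => // ->; rewrite eqxx.
  by have /= -> := fP (Negz j); rewrite raddf0.
Qed.

Lemma mixed_piece_x : ga_piece 1 x.
Proof. by apply/piece_hcomp; apply: mixedP; rewrite /= ?coef0 ?scale0r. Qed.

Lemma mixed_piece_y : ga_piece 1 y.
Proof. by apply/piece_hcomp; apply: mixedP; rewrite /= ?mul0rn // coefX scale1r. Qed.

Lemma mixed_piece_xy : ga_piece 1 (x - y).
Proof.
apply/piece_hcomp; rewrite raddfB /=.
by rewrite (piece_hcomp _ _).1 ?(piece_hcomp _ _).1 //;
  [exact: mixed_piece_y | exact: mixed_piece_x].
Qed.

Lemma mixed_piece_xx : ga_piece 2 v.
Proof. by apply/piece_hcomp; apply: mixedP; rewrite /= ?coef0 ?scale0r. Qed.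

End Instance.

Theorem theorem3p6 (k : fieldType) :
  exists (d : nat) (C : graded_alg k d) (P : graded_resolution C),
    [/\ (2 < d)%N,
        two_d_determined P,
        infinite_gldim C,
        yoneda_fin_gen P
      & ~ is_K2 P].
Proof.
exists 3, (mixed_ga k).
exists (per_gres (@mixed_piece_x k) (@mixed_piece_y k) (@mixed_piece_xy k) (@mixed_piece_xx k)
  (@mixed_reg_grading k) (@ann_x k) (@ann_y k) (@ann_xy k) (@ann_xx k) (@aug_ideal k)
  (@xy_direct k)).
(* The remaining hypotheses compare single coordinates of explicit left and right multiples of [x],
   [x - y] and [x^2]. *)
have aug_xy (a b c : mixed k) :
    a * mixed_x k + b * mixed_y k = mixed_x k * c -> mixed_aug a = mixed_aug c.
  by rewrite mixed_mulx mixed_muly mixed_xmul => /(congr1 (@cx k)); rewrite coordE /= addr0.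
have aug_z (a c : mixed k) :
    a * (mixed_x k - mixed_y k) = (mixed_x k - mixed_y k) * c -> mixed_aug a = mixed_aug c.
  by rewrite mixed_mulxy mixed_xymul => /(congr1 (@cx k)).
have aug_v (a c : mixed k) : a * mixed_xx k = mixed_xx k * c -> mixed_aug a = mixed_aug c.
  by rewrite mixed_mulxx mixed_xxmul => /(congr1 (@cxx k)).
have aug_x_v (a b : mixed k) : a * mixed_x k = mixed_xx k * b -> mixed_aug a = 0.
  by rewrite mixed_mulx mixed_xxmul => /(congr1 (@cx k)).
have aug_z_v (a b : mixed k) : a * (mixed_x k - mixed_y k) = mixed_xx k * b -> mixed_aug a = 0.
  by rewrite mixed_mulxy mixed_xxmul => /(congr1 (@cx k)).
have aug_xy_v (a b c : mixed k) :
    a * mixed_x k + b * mixed_y k = mixed_xx k * c -> mixed_aug a = 0 /\ mixed_aug b = 0.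
  rewrite mixed_mulx mixed_muly mixed_xxmul => e; split.
    by have := congr1 (@cx k) e; rewrite coordE /= addr0.
  have /eqP := congr1 (@cy k) e; rewrite coordE /= add0r mulf_eq0 polyX_eq0 orbF => /eqP b0.
  by rewrite /mixed_aug b0 coef0.
have zx0 : (mixed_x k - mixed_y k) * mixed_x k = 0.
  by rewrite mixed_xymul; apply: mixedP; rewrite /= ?coef0 ?mulr0 ?oppr0.
have vz0 : mixed_xx k * (mixed_x k - mixed_y k) = 0.
  by rewrite mixed_xxmul; apply: mixedP; rewrite /= ?coefD ?coefN ?coefX ?coef0 ?subr0.
have xv0 : mixed_x k * mixed_xx k = 0 by rewrite mixed_xmul; apply: mixedP; rewrite /= ?coef0.
split=> //.
- exact: per_two_d_determined.
- exact: (per_infinite_gldim (mixed_piece_x k) (@ann_x k) (@ann_y k) (@ann_xy k)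
    (@ann_xx k) (@aug_ideal k) (@xy_direct k) zx0 vz0 xv0 aug_xy aug_z aug_v).
- exact: per_fin_gen.
- by apply: per_not_K2; [exact: aug_x_v | exact: aug_z_v | exact: aug_xy_v].
Qed.
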